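(* Let $2 < p < \infty$, let $(X,\Sigma,\mu)$ be a separable measure space such that $Z = L_p(X,\Sigma,\mu)$ is infinite-dimensional. Then for each $k \in \mathbb{N}$ there exists a renorming $E_k$ of $\ell_1$ (that is, $E_k$ is the vector space $\ell_1$ equipped with a norm equivalent to $\|\cdot\|_1$) such that $$k \leq \mathcal{CR}(Z, E_k) < \infty.$$
   Context: For metric spaces $(M_1,d_1)$, $(M_2,d_2)$ and an arbitrary (not necessarily continuous) map $\phi: M_1\to M_2$, define for $t\in(0,\infty)$ $$\kappa_\phi(t)=\inf_{d_1(x,y)\ge t} d_2(\phi(x),\phi(y)),\qquad \omega_\phi(t)=\sup_{d_1(x,y)\le t} d_2(\phi(x),\phi(y)),$$ with values in $[0,\infty]$, and $\kappa(\phi)=\sup_{t<\infty}\kappa_\phi(t)=\lim_{t\to\infty}\kappa_\phi(t)$, $\omega(\phi)=\inf_{t>0}\omega_\phi(t)=\lim_{t\to0}\omega_\phi(t)$. The separation ratio of $\phi$ is $\mathcal{R}(\phi)=\kappa(\phi)/\omega(\phi)\in[0,\infty]$, with the conventions $\frac{a}{\infty}=\frac{0}{a}=0$ for all $a\in[0,\infty]$ and $\frac{a}{0}=\frac{\infty}{a}=\frac{\infty}{0}=\infty$ for all $a\in(0,\infty)$. The coarse embeddability ratio is $\mathcal{CR}(M_1,M_2)=\sup_\phi \mathcal{R}(\phi)$, the supremum over all maps $\phi:M_1\to M_2$. Banach spaces carry their norm metric. $L_p(X,\Sigma,\mu)$ is the space of real-valued functions with the usual $L_p$ norm. A measure space is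 separable if the collection of measurable sets of finite measure, modulo null sets, with distance $\mu(A\bigtriangleup B)$ is separable (so that $L_p(X,\Sigma,\mu)$ is a separable Banach space for $1 \le p<\infty$). *)

(* Defs.v *)
From HB Require Import structures.
From mathcomp Require Import all_boot all_order all_algebra.
From mathcomp Require Import all_classical all_reals all_analysis.
From mathcomp Require Import measurable_realfun ess_sup_inf.

Set Implicit Arguments.
Unset Strict Implicit.
Unset Printing Implicit Defensive.
Import Order.TTheory GRing.Theory Num.Theory.
Import numFieldNormedType.Exports.
Local Open Scope classical_set_scope.
Local Open Scope ring_scope.

(* The library only provides [LspaceType mu p1] as a bare type of classes of
   a.e. equal measurable functions with finite Lp-norm: it is equipped below
   with its vector space structure, its norm and the norm metric. *)
Section Lspace_repr.
Context d (T : measurableType d) (R : realType).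
Variables (mu : {measure set T -> \bar R}) (p : \bar R) (p1 : (1 <= p)%E).

Local Notation M := {mfun_ mu, T >-> measurableTypeR R}.
Local Notation Lp := (LspaceType mu p1).
Local Notation Lf := (LfunType mu p1).

Lemma ae_eq_Lnorm (f g : T -> R) : measurable_fun setT f ->
  measurable_fun setT g -> f = g %[ae mu] ->
  ('N[mu]_p[EFin \o f] = 'N[mu]_p[EFin \o g])%E.
Proof.
move=> mf mg fg; rewrite unlock; case: p p1 => [r r1| _ |//].
- have mN (h : T -> R) : measurable_fun setT h ->
      measurable_fun setT (fun x => `|(EFin \o h) x| `^ r)%E.
    move=> mh; apply: (measurableT_comp (measurable_poweR r)).
    by apply: measurableT_comp => //; exact/measurable_EFinP.
  congr (_ `^ _)%E; apply: ge0_ae_eq_integral => //.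
  + exact: mN.
  + exact: mN.
  + by move=> x _; exact: poweR_ge0.
  + by move=> x _; exact: poweR_ge0.
  + by apply: filterS fg => x + Dx => /= ->.
- case: ifPn => // _; apply: eq_ess_sup.
  by apply: filterS fg => x /= -> //.
Qed.

Definition Lsp_fun (F : Lp) : T -> R := repr (F : M).

Lemma Lsp_fun_mfun (F : Lp) : measurable_fun setT (Lsp_fun F).
Proof. exact: (@measurable_funPT _ _ _ _ (repr (F : M))). Qed.

Lemma Lsp_funP (F : Lp) : Lsp_fun F \in Lfun mu p.
Proof.
apply/andP; split; first by rewrite inE; exact: Lsp_fun_mfun.
by rewrite inE; exact: (@Lebesgue_finite _ _ _ _ _ _ F).
Qed.

Definition Lsp_repr (F : Lp) : Lf := Lfun_Sub p1 (Lsp_funP F).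

Lemma Lf_measurable (f : Lf) : measurable_fun setT (f : T -> R).
Proof. exact: (@measurable_funPT _ _ _ _ (f : {mfun T >-> R})). Qed.

Lemma Lf_mfunP (f : Lf) : (f : T -> measurableTypeR R) \in mfun.
Proof. by rewrite inE; exact: Lf_measurable. Qed.

Definition Lsp_pi (f : Lf) : M := (\pi_M (mfun_Sub (Lf_mfunP f)))%qT.

Lemma Lsp_pi_ae (f : Lf) : (repr (Lsp_pi f) : T -> R) = (f : T -> R) %[ae mu].
Proof.
have /eqP : (\pi_M (repr (Lsp_pi f)) = \pi_M (mfun_Sub (Lf_mfunP f)))%qT.
  by rewrite reprK.
by rewrite eqmodE => /asboolP.
Qed.

Lemma Lsp_piP (f : Lf) : finite_norm mu p (Lsp_pi f).
Proof.
rewrite /finite_norm (ae_eq_Lnorm _ _ (Lsp_pi_ae f)).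
- exact: Lfunction_finite.
- exact: (@measurable_funPT _ _ _ _ (repr (Lsp_pi f))).
- exact: Lf_measurable.
Qed.

Definition Lsp_class (f : Lf) : Lp := HB.pack_for Lp (Lsp_pi f)
  (isFinLebesgue.Build d T R mu p p1 _ (Lsp_piP f)).

Lemma Lsp_inj (F G : Lp) : F = G :> M -> F = G.
Proof.
case: F G => [F [[cF]]] [G [[cG]]] /= FG; subst G.
by rewrite (Prop_irrelevance cF cG).
Qed.

Lemma Lsp_reprK F : Lsp_class (Lsp_repr F) = F.
Proof.
apply: Lsp_inj; rewrite -[RHS]reprK; apply/eqP; rewrite eqmodE; apply/asboolP.
exact: aeW.
Qed.

Lemma Lsp_classK f : (Lsp_repr (Lsp_class f) : T -> R) = (f : T -> R) %[ae mu].
Proof. exact: Lsp_pi_ae. Qed.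

Lemma Lsp_class_eq (f g : Lf) : (f : T -> R) = (g : T -> R) %[ae mu] ->
  Lsp_class f = Lsp_class g.
Proof.
by move=> fg; apply: Lsp_inj; apply/eqP; rewrite eqmodE; apply/asboolP.
Qed.

End Lspace_repr.

Section Lspace_lmodule.
Context d (T : measurableType d) (R : realType).
Variables (mu : {measure set T -> \bar R}) (p : \bar R) (p1 : (1 <= p)%E).

Local Notation Lp := (LspaceType mu p1).
Implicit Types F G H : Lp.

HB.instance Definition _ := gen_eqMixin Lp.
HB.instance Definition _ := gen_choiceMixin Lp.

Definition Lsp0 : Lp := Lsp_class 0.
Definition Lsp_opp F : Lp := Lsp_class (- Lsp_repr F).
Definition Lsp_add F G : Lp := Lsp_class (Lsp_repr F + Lsp_repr G).
Definition Lsp_scale (a : R) F : Lp := Lsp_class (a *: Lsp_repr F).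

Lemma Lsp_addE (f g : LfunType mu p1) :
  Lsp_add (Lsp_class f) (Lsp_class g) = Lsp_class (f + g).
Proof.
apply: Lsp_class_eq; apply: filterS2 (Lsp_classK f) (Lsp_classK g).
by move=> x fx gx _; exact: (congr2 +%R (fx I) (gx I)).
Qed.

Lemma Lsp_oppE (f : LfunType mu p1) :
  Lsp_opp (Lsp_class f) = Lsp_class (- f).
Proof.
apply: Lsp_class_eq; apply: filterS (Lsp_classK f).
by move=> x fx _; exact: (congr1 -%R (fx I)).
Qed.

Lemma Lsp_scaleE a (f : LfunType mu p1) :
  Lsp_scale a (Lsp_class f) = Lsp_class (a *: f).
Proof.
apply: Lsp_class_eq; apply: filterS (Lsp_classK f).
by move=> x fx _; exact: (congr1 ( *%R a) (fx I)).
Qed.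

Lemma Lsp_addA : associative Lsp_add.
Proof.
move=> F G H; rewrite -(Lsp_reprK F) -(Lsp_reprK G) -(Lsp_reprK H).
by rewrite !Lsp_addE addrA.
Qed.

Lemma Lsp_addC : commutative Lsp_add.
Proof. by move=> F G; rewrite /Lsp_add addrC. Qed.

Lemma Lsp_add0 : left_id Lsp0 Lsp_add.
Proof. by move=> F; rewrite -(Lsp_reprK F) Lsp_addE add0r. Qed.

Lemma Lsp_addN : left_inverse Lsp0 Lsp_opp Lsp_add.
Proof. by move=> F; rewrite -(Lsp_reprK F) Lsp_oppE Lsp_addE addNr. Qed.

HB.instance Definition _ :=
  GRing.isZmodule.Build Lp Lsp_addA Lsp_addC Lsp_add0 Lsp_addN.

Lemma Lsp_scaleA a b F : Lsp_scale a (Lsp_scale b F) = Lsp_scale (a * b) F.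
Proof. by rewrite -(Lsp_reprK F) !Lsp_scaleE scalerA. Qed.

Lemma Lsp_scale1 : left_id 1 Lsp_scale.
Proof. by move=> F; rewrite -(Lsp_reprK F) Lsp_scaleE scale1r. Qed.

Lemma Lsp_scaleDr : right_distributive Lsp_scale Lsp_add.
Proof.
move=> a F G; rewrite -(Lsp_reprK F) -(Lsp_reprK G).
by rewrite Lsp_addE !Lsp_scaleE Lsp_addE scalerDr.
Qed.

Lemma Lsp_scaleDl F a b :
  Lsp_scale (a + b) F = Lsp_add (Lsp_scale a F) (Lsp_scale b F).
Proof. by rewrite -(Lsp_reprK F) !Lsp_scaleE Lsp_addE scalerDl. Qed.

HB.instance Definition _ := GRing.Zmodule_isLmodule.Build R Lp
  Lsp_scaleA Lsp_scale1 Lsp_scaleDr Lsp_scaleDl.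

Definition Lsp_norm F : R := fine ('N[mu]_p[EFin \o Lsp_repr F])%E.

Lemma Lsp_normE (f : LfunType mu p1) :
  Lsp_norm (Lsp_class f) = fine ('N[mu]_p[EFin \o f])%E.
Proof.
congr fine; apply: (ae_eq_Lnorm p1) (Lsp_classK f).
- exact: Lf_measurable.
- exact: Lf_measurable.
Qed.

Lemma Lsp_normD F G : Lsp_norm (F + G) <= Lsp_norm F + Lsp_norm G.
Proof. by rewrite Lsp_normE; exact: ler_LnormD. Qed.

Lemma Lsp_normZ a F : Lsp_norm (a *: F) = `|a| * Lsp_norm F.
Proof.
rewrite Lsp_normE; apply: EFin_inj.
by rewrite EFinM /Lsp_norm !finite_norm_fine LnormZ.
Qed.

Lemma Lsp_norm_eq0 F : Lsp_norm F = 0 -> F = 0.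
Proof.
move=> /fine_Lnormr_eq0 F0; rewrite -(Lsp_reprK F); exact: Lsp_class_eq.
Qed.

HB.instance Definition _ := Lmodule_isNormed.Build R Lp
  Lsp_normD Lsp_normZ Lsp_norm_eq0.

End Lspace_lmodule.

Section norm_metric.
Context (R : realType) (V : normedModType R).
Implicit Types x y : V.

Definition norm_dist x y : R := `|x - y|.

Lemma norm_dist_ge0 x y : 0 <= norm_dist x y. Proof. exact: normr_ge0. Qed.

Lemma norm_dist_eq0 x y : norm_dist x y = 0 -> x = y.
Proof. by move/normr0_eq0/eqP; rewrite subr_eq0 => /eqP. Qed.

Lemma ball_norm_dist x e : ball x e = [set y | norm_dist x y < e].
Proof. by rewrite -ball_normE. Qed.

End norm_metric.

HB.instance Definition _ d (T : measurableType d) (R : realType)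
    (mu : {measure set T -> \bar R}) (p : \bar R) (p1 : (1 <= p)%E) :=
  PseudoMetric_isMetric.Build R (LspaceType mu p1)
    (@norm_dist_ge0 R (LspaceType mu p1)) (@norm_dist_eq0 R (LspaceType mu p1))
    (@ball_norm_dist R (LspaceType mu p1)).

Lemma Lsp_mdistE d (T : measurableType d) (R : realType)
    (mu : {measure set T -> \bar R}) (p : \bar R) (p1 : (1 <= p)%E)
    (F G : LspaceType mu p1) :
  mdist F G = fine ('N[mu]_p[EFin \o (Lsp_fun F \- Lsp_fun G)%R])%E.
Proof.
rewrite -[LHS]/(Lsp_norm (Lsp_add F (Lsp_opp G))).
rewrite -{1}(Lsp_reprK F) -{1}(Lsp_reprK G) Lsp_oppE Lsp_addE.
exact: Lsp_normE.
Qed.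

Section ell1.
Context (R : realType).

Definition ell1_pred : pred (nat -> R) :=
  fun u => `[< cvgn (series (fun n => `|u n|)) >].

Lemma ell1_submod_closed : submod_closed ell1_pred.
Proof.
split=> [|a u v /asboolP cu /asboolP cv]; apply/asboolP.
  rewrite (_ : series _ = cst 0); first exact: is_cvg_cst.
  by apply/funext => n; rewrite /series /= big1// => i _; rewrite normr0.
apply: (@series_le_cvg _ _ (fun n => `|a| * `|u n| + `|v n|)).
- by move=> n; exact: normr_ge0.
- by move=> n; rewrite addr_ge0// mulr_ge0.
- move=> n; rewrite (le_trans (ler_normD _ _))// lerD2r.
  by rewrite normrM.
- rewrite (_ : series _ =
    `|a| *: series (fun n => `|u n|) + series (fun n => `|v n|)).
    by apply: is_cvgD => //; exact: is_cvgZl_tmp.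
  by apply/funext => n; rewrite /series /= big_split/= -mulr_sumr.
Qed.

HB.instance Definition _ := GRing.isSubmodClosed.Build R (nat -> R) ell1_pred
  ell1_submod_closed.

Record ell1 := Ell1 { ell1_seq :> nat -> R; _ : ell1_pred ell1_seq }.

HB.instance Definition _ := [isSub for ell1_seq].
HB.instance Definition _ := [Choice of ell1 by <:].
HB.instance Definition _ := [SubChoice_isSubLmodule of ell1 by <:].

Definition ell1_norm (u : ell1) : R := limn (series (fun n => `|u n|)).

Lemma ell1_cvg (u : ell1) : cvgn (series (fun n => `|u n|)).
Proof. by case: u => u /= /asboolP. Qed.

Lemma ell1_normZ a u : ell1_norm (a *: u) = `|a| * ell1_norm u.
Proof.
have -> : ell1_norm (a *: u) = limn (`|a| *: series (fun n => `|u n|)).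
  rewrite /ell1_norm; congr (limn _); apply/funext => n.
  rewrite /series /= [RHS]scaler_sumr; apply: eq_bigr => i _.
  by rewrite normrM.
by rewrite limZl_tmp//; exact: ell1_cvg.
Qed.

Lemma ell1_normD u v : ell1_norm (u + v) <= ell1_norm u + ell1_norm v.
Proof.
rewrite /ell1_norm -limD; [|exact: ell1_cvg|exact: ell1_cvg].
have cD : cvgn (series (fun n => `|u n|) + series (fun n => `|v n|)).
  by apply: is_cvgD; exact: ell1_cvg.
rewrite (_ : _ + _ = series (fun n => `|u n| + `|v n|)) in cD *; last first.
  by apply/funext => n; rewrite /series /= big_split.
apply: ler_lim => //; first exact: ell1_cvg.
by near=> n; rewrite /series /= ler_sum// => i _; exact: ler_normD.
Unshelve. all: by end_near. Qed.

Lemma ell1_norm_eq0 u : ell1_norm u = 0 -> u = 0.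
Proof.
move=> u0; apply/val_inj/funext => n; apply/normr0_eq0/eqP.
rewrite eq_le normr_ge0 andbT -{}u0.
have nd : nondecreasing_seq (series (fun n => `|u n|)).
  exact: nondecreasing_series.
apply: le_trans (nondecreasing_cvgn_le nd (@ell1_cvg u) n.+1).
by rewrite /series /= big_nat_recr//= lerDr sumr_ge0.
Qed.

HB.instance Definition _ := Lmodule_isNormed.Build R ell1
  ell1_normD ell1_normZ ell1_norm_eq0.

End ell1.

Section renorming.
Context (R : realType) (V : normedModType R).

Record equiv_norm := EquivNorm {
  rnorm :> V -> R ;
  rnormD : forall x y, rnorm (x + y) <= rnorm x + rnorm y ;
  rnormZ : forall a x, rnorm (a *: x) = `|a| * rnorm x ;
  rnorm_eq0 : forall x, rnorm x = 0 -> x = 0 ;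
  rnorm_equiv : exists c C : R,
    [/\ 0 < c, 0 < C & forall x, c * `|x| <= rnorm x <= C * `|x|] }.

(* [renormed N] is the vector space V with N as its norm. *)
Definition renormed of equiv_norm : Type := V.

Variable N : equiv_norm.

HB.instance Definition _ := GRing.Lmodule.copy (renormed N) V.
HB.instance Definition _ := Lmodule_isNormed.Build R (renormed N)
  (rnormD N) (rnormZ N) (@rnorm_eq0 N).
HB.instance Definition _ := PseudoMetric_isMetric.Build R (renormed N)
  (@norm_dist_ge0 R (renormed N)) (@norm_dist_eq0 R (renormed N))
  (@ball_norm_dist R (renormed N)).

End renorming.

Section coarse_ratio.
Context (R : realType) (M1 M2 : metricType R).
Implicit Types (phi : M1 -> M2) (t : R).
Local Open Scope ereal_scope.

(* An infimum over no pair is +oo, as it should be in [0, +oo]. A supremum over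
   no pair or no map would be -oo instead of 0, which can only happen when M1 or
   M2 is empty. *)
Definition kappa_at phi t : \bar R :=
  ereal_inf [set (mdist (phi xy.1) (phi xy.2))%:E
            | xy in [set xy : M1 * M1 | (t <= mdist xy.1 xy.2)%R]].

Definition omega_at phi t : \bar R :=
  ereal_sup [set (mdist (phi xy.1) (phi xy.2))%:E
            | xy in [set xy : M1 * M1 | (mdist xy.1 xy.2 <= t)%R]].

Definition kappa phi : \bar R :=
  ereal_sup [set kappa_at phi t | t in [set t | (0 < t)%R]].

Definition omega phi : \bar R :=
  ereal_inf [set omega_at phi t | t in [set t | (0 < t)%R]].

(* On [0, +oo], the division of extended reals satisfies
   a / +oo = 0 / a = 0 for all a (so 0 / 0 = +oo / +oo = 0), and
   a / 0 = +oo / a = +oo / 0 = +oo for 0 < a < +oo. *)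
Definition separation_ratio phi : \bar R := kappa phi / omega phi.

Definition CR : \bar R := ereal_sup (range separation_ratio).

End coarse_ratio.
Arguments CR {R} M1 M2.

(* A countable family D of measurable sets of finite measure is dense for the
   pseudometric mu (A `+` B) iff its image is dense among classes mod null sets. *)
Definition separable_measure d (X : measurableType d) (R : realType)
    (mu : {measure set X -> \bar R}) :=
  exists D : set (set X),
    [/\ countable D,
        forall B, D B -> measurable B /\ (mu B < +oo)%E
      & forall (A : set X) (e : R), measurable A -> (mu A < +oo)%E -> 0 < e ->
          exists2 B, D B & (mu (A `+` B) < e%:E)%E].

Definition finite_dimensional (R : realType) (V : lmodType R) :=
  exists (n : nat) (b : 'I_n -> V),
    forall x : V, exists a : 'I_n -> R, x = \sum_(i < n) a i *: b i.

Lemma exponent_ge1 (R : realType) (p : R) : 2 < p -> (1 <= p%:E)%E.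
Proof. by move=> p2; rewrite lee_fin (le_trans _ (ltW p2))// ler1n. Qed.

(* Main.v *)
Require Import Defs.
From HB Require Import structures.
From mathcomp Require Import all_boot all_order all_algebra.
From mathcomp Require Import all_classical all_reals all_analysis.
From mathcomp Require Import measurable_realfun.
From mathcomp Require Import ring lra zify.

(* Lower bound. Let (z_n) be dense in Z and K the set of g : nat -> R with
   |g| <= k and |g n - g m| <= 1 whenever |z_n - z_m| <= 1. The norm
   u |-> sup_(g in K) |sum_n g_n u_n| is equivalent to the l_1 norm because K
   contains all g with |g| <= 1/2 (it is a Lipschitz-free norm over a bounded
   net). Mapping x to the basis vector e_n, with z_n close to x, sends nearby
   points to distance at most 1 and far away points to distance k.

   Upper bound. Up to the equivalence constants of the renorming, the target is
   l_1, and it is enough to bound kappa by 18 omega there. This follows from the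
   metric cotype 2 inequality on the discrete torus (Z/4L)^n,
     sum_j E |F(x + 2L e_j) - F(x)| <= (12 L^2 + 6 n) E |F(x + eps) - F(x)|,
   eps uniform in {-1, 1}^n. It is first proved for squared differences of real
   functions, where the averages over x + eps and x - eps along each coordinate
   are commuting contractions of l_2 that satisfy a Pythagorean identity; cuts
   transfer it to absolute values. As Z is infinite-dimensional it contains
   l_p^(2n) isometrically, hence a copy of the torus with n = L^2 in which steps
   eps have length at most (2n)^(1/p) and antipodes are at distance at least L.
   Since p > 2, L / (2 L^2)^(1/p) is unbounded. *)

Set Implicit Arguments.
Unset Strict Implicit.
Unset Printing Implicit Defensive.
Import Order.TTheory GRing.Theory Num.Theory.
Import numFieldNormedType.Exports.
Local Open Scope ring_scope.

(** * A metric cotype inequality on finite abelian groups *)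

Section poincare.
Context (R : realFieldType) (G : finZmodType).
Implicit Types (f u v : G -> R) (e x y : G) (s : seq G).

Definition half_sum e u : G -> R := fun x => (u (x + e) + u (x - e)) / 2.
Definition half_diff e u : G -> R := fun x => (u (x + e) - u (x - e)) / 2.

(** The expectation of [u (x + eps)], where [eps] is the sum of the entries of [s] with independent
    uniform signs. Taking one sign at a time makes it a product of commuting half sums. *)
Fixpoint cube_avg s u : G -> R :=
  if s is e :: s' then cube_avg s' (half_sum e u) else u.

Definition sqnorm u : R := \sum_x u x ^+ 2.

Lemma sqnorm_ge0 u : 0 <= sqnorm u.
Proof. by apply: sumr_ge0 => x _; exact: sqr_ge0. Qed.

Lemma sum_shift u e : \sum_x u (x + e) = \sum_x u x.
Proof. by rewrite [RHS](reindex_inj (addIr e)). Qed.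

(** The parallelogram identity for [u (x + e)] and [u (x - e)], summed over the
    translation-invariant group. *)
Lemma sqnorm_half e u :
  sqnorm (half_sum e u) + sqnorm (half_diff e u) = sqnorm u.
Proof.
rewrite /sqnorm -big_split /=.
rewrite (eq_bigr (fun x => u (x + e) ^+ 2 / 2 + u (x - e) ^+ 2 / 2)); last first.
  by move=> x _; rewrite /half_sum /half_diff; field.
rewrite big_split /= (sum_shift (fun x => u x ^+ 2 / 2)).
rewrite (sum_shift (fun x => u x ^+ 2 / 2)) -big_split /=.
by apply: eq_bigr => x _; field.
Qed.

Lemma eq_cube_avg s u v : u =1 v -> cube_avg s u =1 cube_avg s v.
Proof.
elim: s u v => [|e s IH] u v uv //=; apply: IH => x.
by rewrite /half_sum !uv.
Qed.

Lemma cube_avgZD s a u v x :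
  cube_avg s (fun y => a * u y + v y) x = a * cube_avg s u x + cube_avg s v x.
Proof.
elim: s u v => [|e s IH] u v //=; rewrite -IH; apply: eq_cube_avg => y.
by rewrite /half_sum; field.
Qed.

Lemma le_cube_avg s u v x : (forall y, u y <= v y) ->
  cube_avg s u x <= cube_avg s v x.
Proof.
elim: s u v => [|e s IH] u v uv //=; apply: IH => y.
by rewrite /half_sum ler_pM2r ?invr_gt0// lerD.
Qed.

Lemma cube_avg_cst s a x : cube_avg s (fun=> a) x = a.
Proof.
elim: s => //= e s IH; rewrite -{2}IH; apply: eq_cube_avg => y.
by rewrite /half_sum; field.
Qed.

Lemma sum_half_sum e u : \sum_x half_sum e u x = \sum_x u x.
Proof.
by rewrite /half_sum -mulr_suml big_split /= !sum_shift; field.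
Qed.

Lemma sum_cube_avg s u : \sum_x cube_avg s u x = \sum_x u x.
Proof. by elim: s u => //= e s IH u; rewrite IH sum_half_sum. Qed.

Lemma cube_avg_half_diff s e u :
  cube_avg s (half_diff e u) =1 half_diff e (cube_avg s u).
Proof.
elim: s u => //= e' s IH u x; rewrite -IH; apply: eq_cube_avg => y.
rewrite /half_sum /half_diff (addrAC y e') (addrAC y e' (- e)).
rewrite (addrAC y (- e')) (addrAC y (- e') (- e)).
by field.
Qed.

Lemma eq_sqnorm u v : u =1 v -> sqnorm u = sqnorm v.
Proof. by move=> uv; apply: eq_bigr => x _; rewrite uv. Qed.

Lemma sqnorm_cube_avg s u : sqnorm (cube_avg s u) <= sqnorm u.
Proof.
elim: s u => //= e s IH u; apply: le_trans (IH _) _.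
by rewrite -(sqnorm_half e u) lerDl sqnorm_ge0.
Qed.

(** Averaging along [e] loses exactly the square norm of [half_diff e f]. Half differences commute
    with averages, which are contractions, so the term of [e] is at most this loss; the losses
    telescope. *)
Lemma sum_half_diff_cube_avg s f :
  \sum_(e <- s) sqnorm (half_diff e (cube_avg s f)) <=
  sqnorm f - sqnorm (cube_avg s f).
Proof.
elim: s f => [|e s IH] f /=; first by rewrite big_nil subrr.
rewrite big_cons -(eq_sqnorm (cube_avg_half_diff s e _)).
have c1 : half_diff e (half_sum e f) =1 half_sum e (half_diff e f).
  by move=> x; rewrite /half_diff /half_sum (addrAC x (- e)); field.
rewrite (eq_sqnorm (eq_cube_avg s c1)).
have h1 := sqnorm_cube_avg (e :: s) (half_diff e f).
have h2 := IH (half_sum e f).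
have h3 := sqnorm_half e f.
rewrite /= in h1; lra.
Qed.

Definition cube_energy s f : R :=
  \sum_x cube_avg s (fun y => (f y - f x) ^+ 2) x.

Lemma cube_energyE s f : cube_energy s f =
  2 * sqnorm f - 2 * \sum_x f x * cube_avg s f x.
Proof.
rewrite /cube_energy; under eq_bigr => x _.
  rewrite (@eq_cube_avg s _
    (* The expanded square is written as two nested forms [a * u + v], whence the factor 1. *)
    (fun y => - (2 * f x) * f y + (1 * f y ^+ 2 + f x ^+ 2))); last first.
    by move=> y; ring.
  rewrite cube_avgZD cube_avgZD cube_avg_cst mul1r.
  over.
rewrite !big_split /= sum_cube_avg !mulr_sumr -/(sqnorm f).
under eq_bigr => x _ do rewrite mulNr -mulrA.
by rewrite sumrN -!mulr_sumr /sqnorm; ring.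
Qed.

(** Used in both directions: the left side and the loss of square norm are nonnegative, so each of
    them is at most the energy. *)
Lemma sqnorm_sub_cube_avg s f :
  sqnorm (fun x => f x - cube_avg s f x) =
  cube_energy s f - (sqnorm f - sqnorm (cube_avg s f)).
Proof.
rewrite cube_energyE /sqnorm.
rewrite (eq_bigr (fun x => f x ^+ 2 + - 2 * (f x * cube_avg s f x) +
  cube_avg s f x ^+ 2)); last by move=> x _; ring.
by rewrite !big_split /= -mulr_sumr; ring.
Qed.

Lemma sqr_sum_le (I : Type) (r : seq I) (a : I -> R) :
  (\sum_(i <- r) a i) ^+ 2 <= (size r)%:R * \sum_(i <- r) a i ^+ 2.
Proof.
elim: r => [|i r IH]; first by rewrite !big_nil expr0n mul0r.
rewrite !big_cons /= -natr1.
set S := \sum_(_ <- _) a _ in IH *; set Q := \sum_(_ <- _) _ in IH *.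
(* The cross terms, by summing [2 * a i * a j <= a i ^+ 2 + a j ^+ 2] over [j]. *)
have : 2 * a i * S <= (size r)%:R * a i ^+ 2 + Q.
  rewrite /S /Q; elim: {IH S Q} r => [|j r IH].
    by rewrite !big_nil mulr0 mul0r addr0.
  rewrite !big_cons /= -natr1.
  set S := \sum_(_ <- _) a _ in IH *; set Q := \sum_(_ <- _) _ in IH *.
  by have := sqr_ge0 (a i - a j); nra.
nra.
Qed.

Lemma sqnorm_shift u e : sqnorm (fun x => u (x + e)) = sqnorm u.
Proof. exact: (sum_shift (fun x => u x ^+ 2)). Qed.

(** The displacement splits into [L] steps of [2e], each of them twice a half difference at the
    midpoint. Cauchy-Schwarz over the steps costs [L], and there are [L] equal norms to add. *)
Lemma sqnorm_long_diff u e L :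
  sqnorm (fun x => u (x + e *+ (2 * L)) - u x) <=
  4 * L%:R ^+ 2 * sqnorm (half_diff e u).
Proof.
pose a l x : R := u (x + e *+ (2 * l.+1)) - u (x + e *+ (2 * l)).
have aE l : sqnorm (a l) = 4 * sqnorm (half_diff e u).
  rewrite -(sqnorm_shift (half_diff e u) (e *+ (2 * l).+1)) /sqnorm mulr_sumr.
  apply: eq_bigr => x _; rewrite /a /half_diff.
  have -> : x + e *+ (2 * l.+1) = x + e *+ (2 * l).+1 + e.
    by rewrite -addrA -mulrSr mulnS.
  have -> : x + e *+ (2 * l) = x + e *+ (2 * l).+1 - e.
    by rewrite mulrSr addrA addrK.
  by field.
have tel x : u (x + e *+ (2 * L)) - u x = \sum_(l <- iota 0 L) a l x.
  have := telescope_sumr (fun l => u (x + e *+ (2 * l))) (leq0n L).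
  by rewrite /index_iota subn0 muln0 addr0 => <-.
rewrite (eq_sqnorm tel) /sqnorm.
apply: (@le_trans _ _ (\sum_x L%:R * \sum_(l <- iota 0 L) a l x ^+ 2)).
  by apply: ler_sum => x _; have := sqr_sum_le (iota 0 L) (a^~ x); rewrite size_iota.
rewrite -mulr_sumr exchange_big /=.
rewrite (eq_bigr (fun=> 4 * sqnorm (half_diff e u))); last by move=> l _; exact: aE.
rewrite big_const_seq count_predT size_iota iter_addr_0 -[_ *+ L]mulr_natl /sqnorm.
by rewrite le_eqVlt; apply/orP; left; apply/eqP; ring.
Qed.

(** Compare [f] with its average [P] at both ends of the displacement. Convexity costs a factor 3:
    the long differences of [P] give 3 times [4 * L ^ 2] times the total loss, and the two errors
    [f - P] give 3 times 2 energies for each [e]. *)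
Lemma poincare_sqr s f L :
  \sum_(e <- s) sqnorm (fun x => f (x + e *+ (2 * L)) - f x) <=
  (12 * L%:R ^+ 2 + 6 * (size s)%:R) * cube_energy s f.
Proof.
set P := cube_avg s f; set E := cube_energy s f.
have PE := sqnorm_sub_cube_avg s f; rewrite -/P -/E in PE.
have H1 := sum_half_diff_cube_avg s f; rewrite -/P in H1.
have PP := sqnorm_cube_avg s f; rewrite -/P in PP.
have Q0 := sqnorm_ge0 (fun x => f x - P x).
set Q := sqnorm (fun x => f x - P x) in PE Q0.
apply: (@le_trans _ _ (\sum_(e <- s)
   (12 * L%:R ^+ 2 * sqnorm (half_diff e P) + 6 * E))); last first.
  rewrite big_split /= -mulr_sumr big_const_seq count_predT iter_addr_0.
  rewrite -[_ *+ size s]mulr_natl.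
  have : 0 <= L%:R ^+ 2 :> R by exact: sqr_ge0.
  nra.
apply: ler_sum => e _; set h := e *+ (2 * L).
have H2 := sqnorm_long_diff P e L; rewrite -/h in H2.
apply: (@le_trans _ _ (3 * sqnorm (fun x => P (x + h) - P x) + 6 * Q)); last by lra.
have -> : 6 * Q = 3 * (sqnorm (fun x => f (x + h) - P (x + h)) + Q).
  by rewrite (sqnorm_shift (fun x => f x - P x)) -/Q; lra.
rewrite /Q /sqnorm -!mulrDr -!big_split /=.
rewrite mulr_sumr; apply: ler_sum => x _.
set a := P (x + h) - P x; set b := f (x + h) - P (x + h); set c := f x - P x.
have -> : f (x + h) - f x = a + b - c by rewrite /a /b /c; ring.
have := sqr_ge0 (a - b); have := sqr_ge0 (a + c); have := sqr_ge0 (b + c).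
nra.
Qed.

(** Layer-cake decomposition, by induction on the number of points where [f] is not minimal. Raising
    the lowest value to the second lowest one, [f v], removes a cut along the set [a f] of
    nonminimal points, weighted by the gap; [v] then becomes minimal. *)
Lemma cut_decomposition (f : G -> R) : exists r : seq (R * {set G}),
  all (fun cA => 0 <= cA.1) r /\ forall x y, `|f y - f x| =
    \sum_(cA <- r) cA.1 * ((y \in cA.2)%:R - (x \in cA.2)%:R) ^+ 2.
Proof.
pose a f := [set x | [exists y, f y < f x]] : {set G}.
have inA g x : (x \in a g) = [exists y, g y < g x] by rewrite inE.
have [n] := ubnP #|a f|; elim: n f => // n IH f; rewrite ltnS => fn.
have [x0 _ x0min] := @Order.TotalTheory.arg_minP _ _ G 0 xpredT f isT.
have [a0|[x1 x1a]] := set_0Vmem (a f).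
  exists [::]; split=> // x y; rewrite big_nil.
  have fx z : f z = f x0.
    apply/eqP; rewrite eq_le x0min// andbT leNgt; apply/negP => h.
    have : z \in a f by rewrite inA; apply/existsP; exists x0.
    by rewrite a0 inE.
  by rewrite !fx subrr normr0.
have [v va vmin] := @Order.TotalTheory.arg_minP _ _ G x1 (mem (a f)) f x1a.
have va' : v \in a f by [].
have fxv : f x0 < f v.
  have := va'; rewrite inA => /existsP[y yv].
  by apply: le_lt_trans yv; exact: x0min.
have nfa x : x \notin a f -> f x = f x0.
  rewrite inA negb_exists => /forallP/(_ x0); rewrite -leNgt => h.
  by apply/eqP; rewrite eq_le h x0min.
have afa x : x \in a f -> f v <= f x by move=> xa; exact: vmin.
pose g x := Num.max (f x) (f v).
have gE x : g x = if x \in a f then f x else f v.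
  rewrite /g; case: ifPn => [/afa h|/nfa ->]; first exact/max_l.
  by apply/max_r/ltW.
have ga : a g \proper a f.
  apply/properP; split.
    apply/fintype.subsetP => x; rewrite inA => /existsP[y].
    rewrite (gE x); case: ifPn => // _; rewrite /g.
    by rewrite gt_max ltxx andbF.
  exists v => //; rewrite inA negb_exists; apply/forallP => y.
  by rewrite (gE v) va' -leNgt /g le_max lexx orbT.
have [r [r0 rE]] := IH g (leq_trans (proper_card ga) fn).
exists ((f v - f x0, a f) :: r); split; first by rewrite /= subr_ge0 ltW.
move=> x y; rewrite big_cons -rE /= !gE.
case: ifPn => ya; case: ifPn => xa.
- by rewrite subrr expr0n mulr0 add0r.
- have := afa _ ya; rewrite (nfa x)// => h; rewrite /= subr0 expr1n mulr1 !ger0_norm; lra.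
- have := afa _ xa; rewrite (nfa y)// => h; rewrite /= sub0r sqrrN expr1n mulr1 !ler0_norm; lra.
- by rewrite (nfa x)// (nfa y)// !subrr normr0 expr0n mulr0 addr0.
Qed.

Lemma cube_avg_sum (I : Type) (r : seq I) (c : I -> R) (u : I -> G -> R) s x :
  cube_avg s (fun y => \sum_(i <- r) c i * u i y) x =
  \sum_(i <- r) c i * cube_avg s (u i) x.
Proof.
elim: r => [|i r IH].
  by rewrite big_nil -[RHS](cube_avg_cst s 0 x); apply: eq_cube_avg => y; rewrite big_nil.
rewrite big_cons -IH -cube_avgZD; apply: eq_cube_avg => y.
by rewrite big_cons.
Qed.

(* Both sides are linear in the kernel [|f y - f x|], a nonnegative combination
   of cut kernels, and on those absolute values and squares agree. *)
Lemma poincare_abs s f L :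
  \sum_(e <- s) \sum_x `|f (x + e *+ (2 * L)) - f x| <=
  (12 * L%:R ^+ 2 + 6 * (size s)%:R) *
  \sum_x cube_avg s (fun y => `|f y - f x|) x.
Proof.
have [r [r0 rE]] := cut_decomposition f.
under eq_bigr => e _ do under eq_bigr => x _ do rewrite rE.
under [X in _ <= _ * X]eq_bigr => x _.
  rewrite (eq_cube_avg _ (rE x)) cube_avg_sum.
  over.
under eq_bigr => e _ do rewrite exchange_big.
rewrite exchange_big [X in _ <= _ * X]exchange_big /= mulr_sumr.
rewrite big_seq [leRHS]big_seq; apply: ler_sum => -[c A] cA /=.
under eq_bigr => e _ do rewrite -mulr_sumr.
rewrite -!mulr_sumr [leRHS]mulrCA.
apply: ler_wpM2l; first exact: (allP r0 _ cA).
exact: poincare_sqr (fun x => (x \in A)%:R) L.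
Qed.

Lemma cube_avg_le s u x (B : R) :
  (forall b : seq bool, size b = size s -> u (x + \sum_(eb <- zip s b)
     (if eb.2 then eb.1 else - eb.1)) <= B) ->
  cube_avg s u x <= B.
Proof.
elim: s u => [|e s IH] u h /=.
  by have := h [::] erefl; rewrite big_nil addr0.
apply: IH => b bs; rewrite /half_sum ler_pdivrMr// mulr_natr mulr2n.
have /= := h (true :: b) (congr1 S bs); have /= := h (false :: b) (congr1 S bs).
rewrite !big_cons /= (addrC e) (addrC (- e)) !addrA => hF hT.
exact: lerD.
Qed.

End poincare.

Local Open Scope classical_set_scope.

(** * The inequality for maps into l_1 *)

Section ell1_target.
Context (R : realType) (G : finZmodType).

Lemma ell1_normr_cvg (u : ell1 R) : series (fun i => `|u i|) @ \oo --> `|u|.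
Proof. exact: ell1_cvg. Qed.

Lemma ell1_partial_le (u : ell1 R) N : series (fun i => `|u i|) N <= `|u|.
Proof.
apply: nondecreasing_cvgn_le; last exact: ell1_cvg.
by apply: nondecreasing_series => i _ _; exact: normr_ge0.
Qed.

(** The scalar inequality is summed over the first [N] coordinates. The left side converges to the
    norms as [N] grows, while partial sums on the right never exceed them. *)
Lemma poincare_ell1 (s : seq G) (F : G -> ell1 R) L :
  \sum_(e <- s) \sum_x `|F (x + e *+ (2 * L)) - F x| <=
  (12 * L%:R ^+ 2 + 6 * (size s)%:R) *
  \sum_x cube_avg s (fun y => `|F y - F x|) x.
Proof.
set C := 12 * _ + _.
have C0 : 0 <= C by rewrite addr_ge0// mulr_ge0// sqr_ge0.
have cv : (fun N => \sum_(e <- s) \sum_x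
    series (fun i => `|(F (x + e *+ (2 * L)) - F x) i|) N) @ \oo -->
    \sum_(e <- s) \sum_x `|F (x + e *+ (2 * L)) - F x|.
  apply: cvg_big; first exact: add_continuous.
  move=> e _; apply: cvg_big; first exact: add_continuous.
  by move=> x _; exact: ell1_normr_cvg.
rewrite -(cvg_lim _ cv)//; apply: limr_le; first exact: cvgP cv.
near=> N.
rewrite /series /=; under eq_bigr => e _ do rewrite exchange_big.
rewrite exchange_big /=.
apply: (@le_trans _ _ (\sum_(0 <= i < N)
    C * \sum_x cube_avg s (fun y => `|F y i - F x i|) x)).
  by apply: ler_sum => i _; exact: (poincare_abs s (fun x => F x i)).
rewrite -mulr_sumr exchange_big; apply: ler_wpM2l => //.
apply: ler_sum => x _.
rewrite (eq_bigr (fun i => 1 * cube_avg s (fun y => `|F y i - F x i|) x)); last first.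
  by move=> i _; rewrite mul1r.
rewrite -cube_avg_sum; apply: le_cube_avg => y.
under eq_bigr => i _ do rewrite mul1r.
exact: (ell1_partial_le (F y - F x) N).
Unshelve. all: by end_near. Qed.

End ell1_target.

(** * The discrete torus *)

Section tent.
Context (L : nat) (L0 : (0 < L)%N).
Local Notation m := (4 * L)%N.

(** The graph distance from [n] to 0 on a cycle with [4 * L] vertices. *)
Definition tent (n : nat) : nat := minn (n %% m) (m - n %% m).

Lemma modnD_wrap n k : (k < m)%N ->
  ((n + k) %% m = if n %% m + k < m then n %% m + k else n %% m + k - m)%N.
Proof.
move=> km; rewrite -modnDml.
have nm : (n %% m < m)%N by rewrite ltn_mod; lia.
case: ltnP => h; first by rewrite modn_small.
rewrite -{1}(subnK h) modnDr modn_small//; lia.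
Qed.

Lemma tentS n : (tent n <= (tent n.+1).+1)%N /\ (tent n.+1 <= (tent n).+1)%N.
Proof.
have nm : (n %% m < m)%N by rewrite ltn_mod; lia.
rewrite /tent -(addn1 n) modnD_wrap; last lia.
by case: ifP => h; split; lia.
Qed.

Lemma tent_antipode n : (tent (n + 2 * L) + tent n = 2 * L)%N.
Proof.
have nm : (n %% m < m)%N by rewrite ltn_mod; lia.
rewrite /tent modnD_wrap; last lia.
by case: ifP => h; lia.
Qed.

(* At every point of the cycle, the tent or its translate by a quarter turn is at
   least L/2 away from its mid value L, so it moves by L at the antipode. *)
Lemma tent_far n : [|| 2 * tent n <= L, 3 * L <= 2 * tent n,
  2 * tent (n + L) <= L | 3 * L <= 2 * tent (n + L)]%N.
Proof.
have nm : (n %% m < m)%N by rewrite ltn_mod; lia.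
rewrite /tent modnD_wrap; last lia.
by case: ifP => h; lia.
Qed.

Lemma tent_mod n : tent (n %% m) = tent n.
Proof. by rewrite /tent modn_mod. Qed.

Definition ctent (z : 'Z_m) : nat := tent z.

Lemma ctentDn (z : 'Z_m) n : ctent (z + n%:R) = tent (z + n).
Proof.
have m1 : (1 < m)%N by lia.
rewrite /ctent /= Zp_nat /= -[RHS]tent_mod -[LHS]tent_mod.
have E k : (k %% (Zp_trunc m).+2 = k %% m)%N by rewrite Zp_cast.
by rewrite !E modn_mod modnDmr.
Qed.

Lemma ctent_lip (R : realDomainType) (z w : 'Z_m) : w \in [:: 0; 1; -1] ->
  `|(ctent (z + w))%:R - (ctent z)%:R| <= 1 :> R.
Proof.
have S (y : 'Z_m) : `|(ctent (y + 1))%:R - (ctent y)%:R| <= 1 :> R.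
  rewrite -[X in y + X]/(1%:R) ctentDn addn1 /ctent; have [h1 h2] := tentS y.
  by rewrite ler_distl lerBlDr !natr1 !ler_nat h1 h2.
rewrite !inE => /or3P[] /eqP->; first by rewrite addr0 subrr normr0.
- exact: S.
- by rewrite distrC -{1}(subrK 1 z); exact: S.
Qed.

Lemma ctent_far (R : realDomainType) (z : 'Z_m) :
  L%:R <= `|(ctent (z + (2 * L)%:R))%:R - (ctent z)%:R| :> R \/
  L%:R <= `|(ctent (z + (2 * L)%:R + L%:R))%:R - (ctent (z + L%:R))%:R| :> R.
Proof.
have H (y : 'Z_m) : (2 * ctent y <= L)%N || (3 * L <= 2 * ctent y)%N ->
    L%:R <= `|(ctent (y + (2 * L)%:R))%:R - (ctent y)%:R| :> R.
  rewrite ctentDn /ctent; have := tent_antipode y.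
  move: (tent y) (tent (y + _)) => b a ab /orP[h|h].
    have ba : (b <= a)%N by lia.
    rewrite -natrB// normr_nat ler_nat; lia.
  have ba : (a <= b)%N by lia.
  rewrite distrC -natrB// normr_nat ler_nat; lia.
have := tent_far z; rewrite -ctentDn -/(ctent z) orbA => /orP[h|h].
  by left; exact: H.
by right; rewrite addrAC; exact: H.
Qed.

End tent.

Lemma cube_step_coord (q n : nat) (r : seq 'I_n) (b : seq bool) (j : 'I_n) :
  uniq r -> ((\sum_(eb <- zip [seq delta_mx 0 i | i <- r] b)
    (if eb.2 then eb.1 else - eb.1)) : 'rV['Z_q]_n) 0 j \in [:: 0; 1; -1].
Proof.
move=> ur.
(* The induction also records that coordinates outside [r] stay 0, so that each coordinate receives
   at most one signed unit. *)
suff : let c := (\sum_(eb <- zip [seq delta_mx 0 i | i <- r] b)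
    (if eb.2 then eb.1 else - eb.1) : 'rV['Z_q]_n) 0 j in
    c \in [:: 0; 1; -1] /\ (j \notin r -> c = 0) by case.
elim: r b ur => [|i r IH] [|c b] ur; rewrite ?big_nil ?mxE ?inE ?eqxx//.
have := IH b; move: ur; rewrite /= big_cons mxE => /andP[ir ur] /(_ ur)[h1 h2].
rewrite in_cons negb_or; split; last first.
  move=> /andP[ji jr]; rewrite h2// addr0.
  by case: c; rewrite ?mxE eqxx /= (negbTE ji) ?oppr0.
have [ij|ij] := eqVneq j i.
  rewrite h2 ?ij// addr0.
  by case: c; rewrite ?mxE !eqxx /= !inE eqxx ?orbT.
by case: c; rewrite /= ?mxE eqxx /= (negbTE ij) ?oppr0 add0r -!in_cons.
Qed.

(** * Isometric copies of finite-dimensional l_p in L_p *)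

Section Lp_space.
Context (R : realType) (d : measure_display) (X : measurableType d).
Variables (mu : {measure set X -> \bar R}) (p : R) (p1 : (1 <= p%:E)%E).
Local Notation Lp := (LspaceType mu p1).

Let p_gt0 : 0 < p.
Proof. by apply: lt_le_trans ltr01 _; rewrite -lee_fin. Qed.

Let p_neq0 : p != 0. Proof. exact: lt0r_neq0. Qed.

Lemma Lsp_norm_powR (f : LfunType mu p1) :
  ((`|Lsp_class f| `^ p)%:E = \int[mu]_x (`|f x| `^ p)%:E)%E.
Proof.
rewrite -[`|_|]/(Lsp_norm _) Lsp_normE -poweR_EFin finite_norm_fine.
by rewrite powR_Lnorm.
Qed.

Lemma mem_Lfun (f : X -> R) : measurable_fun setT f ->
  (\int[mu]_x (`|f x| `^ p)%:E < +oo)%E -> f \in Lfun mu p%:E.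
Proof.
move=> mf fi; rewrite inE; apply/andP; split; rewrite inE//=.
by rewrite /finite_norm unlock; exact: poweR_lty.
Qed.

Lemma measurable_powR_norm (f : X -> R) : measurable_fun setT f ->
  measurable_fun setT (fun x => (`|f x| `^ p)%:E : \bar R).
Proof.
move=> mf; apply/measurable_EFinP.
apply: (measurableT_comp (measurable_powR p)).
exact: measurableT_comp.
Qed.

Lemma powR_indic (A : set X) x : `|\1_A x| `^ p = \1_A x :> R.
Proof.
by rewrite indicE; case: (x \in A); rewrite ?normr1 ?powR1// normr0 powR0.
Qed.

Lemma indic_Lfun (A : set X) : measurable A -> (mu A < +oo)%E ->
  (\1_A : X -> R) \in Lfun mu p%:E.
Proof.
move=> mA Aoo; apply: mem_Lfun; first exact: measurable_indic.
under eq_integral do rewrite powR_indic.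
by rewrite integral_indic// setIT.
Qed.

Lemma integrable_Lsp_repr (F : Lp) : (\int[mu]_x (`|Lsp_repr F x| `^ p)%:E < +oo)%E.
Proof. by rewrite -Lsp_norm_powR ltry. Qed.

Lemma Lsp_classD (f g : LfunType mu p1) :
  Lsp_class (f + g) = Lsp_class f + Lsp_class g.
Proof. by rewrite -[RHS]/(Lsp_add _ _) Lsp_addE. Qed.

Lemma Lsp_classZ a (f : LfunType mu p1) :
  Lsp_class (a *: f) = a *: Lsp_class f.
Proof. by rewrite -[RHS]/(Lsp_scale _ _) Lsp_scaleE. Qed.

Lemma Lsp_classB (f g : LfunType mu p1) :
  Lsp_class (f - g) = Lsp_class f - Lsp_class g.
Proof. by rewrite Lsp_classD -scaleN1r Lsp_classZ scaleN1r. Qed.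

Lemma Lsp_class_sum (I : finType) (f : I -> LfunType mu p1) :
  Lsp_class (\sum_i f i) = \sum_i Lsp_class (f i).
Proof. exact: (big_morph _ Lsp_classD). Qed.

Lemma Lfun_sumE (I : finType) (f : I -> LfunType mu p1) x :
  (\sum_i f i : LfunType mu p1) x = \sum_i f i x.
Proof. by apply: (big_morph (fun h : LfunType mu p1 => h x)). Qed.

(** Markov's inequality for the [p]-th power of [f]. *)
Lemma finite_measure_level (f : X -> R) (e : R) : measurable_fun setT f ->
  (\int[mu]_x (`|f x| `^ p)%:E < +oo)%E -> 0 < e ->
  measurable [set x | e <= `|f x|] /\ (mu [set x | (e <= `|f x|)%R] < +oo)%E.
Proof.
move=> mf fi e0.
have mE : measurable [set x | e <= `|f x|].
  rewrite (_ : [set _ | _] = setT `&` (Num.norm \o f) @^-1` `[e, +oo[); last first.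
    by apply/seteqP; split => x /=; rewrite in_itv /= andbT; [|case].
  have mn : measurable_fun setT (Num.norm \o f) by exact: measurableT_comp.
  exact: mn.
split=> //.
have : ((e `^ p)%:E * mu [set x | (e <= `|f x|)%R] < +oo)%E.
  apply: le_lt_trans fi.
  rewrite -[X in (_ * mu X)%E](setIT) -integral_indic// -ge0_integralZl//; last 2 first.
    by apply/measurable_EFinP; exact: measurable_indic.
    by rewrite lee_fin powR_ge0.
  apply: ge0_le_integral => //.
  - by move=> x _; rewrite mule_ge0// lee_fin ?powR_ge0.
  - apply: measurable_funeM; apply/measurable_EFinP; exact: measurable_indic.
  - exact: measurable_powR_norm.
  - move=> x _; rewrite -EFinM lee_fin indicE.
    have [xe|] := boolP (x \in _); last by rewrite mulr0 powR_ge0.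
    rewrite mulr1; apply: ge0_ler_powR; rewrite ?nnegrE ?(ltW p_gt0) ?(ltW e0)//.
    by move: xe; rewrite inE.
have ep : 0 < e `^ p by exact: powR_gt0.
rewrite [in X in X -> _]ltey [in X in _ -> X]ltey; apply: contraNN => /eqP ->.
by rewrite gt0_muley ?lte_fin.
Qed.

Definition disjoint_family (I : finType) (A : I -> set X) :=
  [/\ forall i, measurable (A i), forall i, (0 < mu (A i) < +oo)%E &
      forall i j x, A i x -> A j x -> i = j].

(** [u c] is the combination with coefficients [c] of the indicators of the [A i] scaled to norm
    one. At most one of them is nonzero at each point, so [p]-th powers of norms add up. *)
Lemma disjoint_family_lp_isometry (I : finType) (A : I -> set X) :
  disjoint_family A -> exists u : (I -> R) -> Lp, forall c c',
  `|u c - u c'| `^ p = \sum_i `|c i - c' i| `^ p.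
Proof.
move=> [mA Aoo dA].
have Afin i : (mu (A i) < +oo)%E by case/andP: (Aoo i).
have Agt i : 0 < fine (mu (A i)) by rewrite fine_gt0// Aoo.
pose w i : LfunType mu p1 := (fine (mu (A i)) `^ (- p^-1)) *:
  Lfun_Sub p1 (indic_Lfun (mA i) (Afin i)).
exists (fun c => Lsp_class (\sum_i c i *: w i)) => c c'.
rewrite -Lsp_classB -sumrB; under eq_bigr do rewrite -scalerBl.
apply: EFin_inj; rewrite Lsp_norm_powR.
pose k i := `|c i - c' i| `^ p / fine (mu (A i)).
have k0 i : 0 <= k i by rewrite divr_ge0 ?powR_ge0// ltW.
transitivity (\int[mu]_x (\sum_i (k i)%:E * (\1_(A i) x)%:E)%E)%E.
  apply: eq_integral => x _; rewrite Lfun_sumE sumEFin; congr EFin.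
  have wE i : ((c i - c' i) *: w i) x =
    (c i - c' i) * (fine (mu (A i)) `^ (- p^-1) * \1_(A i) x) by [].
  under eq_bigr do rewrite wE.
  have [[i Ax]|nA] := pselect (exists i, A i x); last first.
    rewrite !big1 ?normr0 ?powR0// => i _; rewrite indicE memNset ?mulr0//.
      by move=> Ax; apply: nA; exists i.
    by move=> Ax; apply: nA; exists i.
  have A0 j : j != i -> \1_(A j) x = 0 :> R.
    by move=> /eqP ji; rewrite indicE memNset// => Aj; apply: ji; exact: dA Aj Ax.
  rewrite (bigD1 i)//= big1 ?addr0; last by move=> j /A0->; rewrite !mulr0.
  rewrite [RHS](bigD1 i)//= big1 ?addr0; last by move=> j /A0->; rewrite mulr0.
  rewrite indicE mem_set// !mulr1 normrM powRM//; congr (_ * _).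
  rewrite ger0_norm ?powR_ge0// -powRrM mulNr mulVf//.
  by rewrite powRN powRr1// ltW.
rewrite ge0_integral_sum//; last 2 first.
  by move=> i; apply: measurable_funeM; apply/measurable_EFinP; exact: measurable_indic.
  by move=> i x _; rewrite mule_ge0// lee_fin.
rewrite -sumEFin; apply: eq_bigr => i _.
rewrite ge0_integralZl//; last 2 first.
  by apply/measurable_EFinP; exact: measurable_indic.
  by rewrite lee_fin.
rewrite integral_indic// setIT /k -{2}(@fineK _ (mu (A i))).
  by rewrite -EFinM divfK// lt0r_neq0.
by rewrite ge0_fin_numE.
Qed.

End Lp_space.

Section infinite_dimension.
Context (R : realType) (d : measure_display) (X : measurableType d).
Variables (mu : {measure set X -> \bar R}) (p : R) (p1 : (1 <= p%:E)%E).
Local Notation Lp := (LspaceType mu p1).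

Lemma negligible_bigcup_count (Q : countType) (N : Q -> set X) :
  (forall q, mu.-negligible (N q)) -> mu.-negligible (\bigcup_q N q).
Proof.
move=> N0; pose N' n := if unpickle n is Some q then N q else set0.
apply: (negligibleS (A := \bigcup_n N' n)).
  by move=> x [q _ Nq]; exists (pickle q); [exact: I|rewrite /N' pickleK].
apply: negligible_bigcup => n; rewrite /N'; case: unpickle => //.
exact: negligible_set0.
Qed.

Lemma const_on_atom (A : set X) (f : X -> R) :
  measurable A -> (0 < mu A)%E -> measurable_fun setT f ->
  (forall B, measurable B -> mu (A `&` B) = 0 \/ mu (A `\` B) = 0) ->
  exists a : R, {ae mu, forall x, A x -> f x = a}.
Proof.
(* Each rational q cuts A into {f <= q} and {f > q}; f takes a single value off
   the union of the null halves. *)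
move=> mA A0 mf atom.
have mf' q : measurable [set x | f x <= q].
  rewrite (_ : [set _ | _] = setT `&` f @^-1` `]-oo, q]); first exact: mf.
  by apply/seteqP; split => x /=; rewrite in_itv /=; [|case].
pose N (q : rat) := if `[< mu (A `&` [set x | f x <= ratr q]) = 0 >]
  then A `&` [set x | f x <= ratr q] else A `\` [set x | f x <= ratr q].
have N0 q : mu.-negligible (N q).
  rewrite /N; case: asboolP => h.
    by apply/negligibleP => //; exact: measurableI.
  apply/negligibleP; first exact: measurableD.
  by case: (atom _ (mf' (ratr q))).
have [x0 Ax0 Nx0] : exists2 x, A x & forall q, ~ N q x.
  apply: contrapT => h.
  have : mu.-negligible A.
    apply: negligibleS (negligible_bigcup_count N0) => x Ax.
  by apply: contrapT => Nx; apply: h; exists x => // q Nq; apply: Nx; exists q.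
  by move=> /negligibleP -/(_ mA) A0'; rewrite A0' ltxx in A0.
exists (f x0).
apply: negligibleS (negligible_bigcup_count N0) => x /= /not_implyP[Ax fx].
have neq : f x != f x0 by apply/eqP.
have [q qx] : exists q, (f x <= ratr q) != (f x0 <= ratr q).
  move: neq; rewrite neq_lt => /orP[] h.
    have [q] := rat_in_itvoo h; rewrite in_itv /= => /andP[q1 q2].
    by exists q; rewrite (ltW q1) leNgt q2.
  have [q] := rat_in_itvoo h; rewrite in_itv /= => /andP[q1 q2].
  by exists q; rewrite (ltW q1) leNgt q2.
apply: contrapT => Nx; move/eqP: qx; apply.
have {}Nx : ~ N q x by move=> Nq; apply: Nx; exists q.
have := Nx0 q; move: Nx; rewrite /N; case: ifPn => _ h h0.
  transitivity false; first by apply/negP => le; apply: h.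
  by apply/esym/negP => le; apply: h0.
transitivity true; first by apply: contrapT => le; apply: h.
by apply/esym; apply: contrapT => le; apply: h0.
Qed.

Lemma disjoint_family_extend n (A : 'I_n -> set X) (B : set X) :
  disjoint_family mu A -> measurable B -> (0 < mu B < +oo)%E ->
  (forall i x, A i x -> ~ B x) ->
  exists A' : 'I_n.+1 -> set X, disjoint_family mu A'.
Proof.
move=> [mA A0 dA] mB B0 AB.
exists (fun i => oapp A B (unlift ord0 i)); split=> [i|i|i j x].
- by case: unliftP => [j _|_] /=.
- by case: unliftP => [j _|_] /=.
- case: unliftP => [i' ->|->]; case: unliftP => [j' ->|->] //=.
  + by move=> Ai Aj; rewrite (dA _ _ _ Ai Aj).
  + by move=> /AB.
  + by move=> Bx /AB.
Qed.

Lemma disjoint_family_split n (A : 'I_n -> set X) (i : 'I_n) (B : set X) :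
  disjoint_family mu A -> measurable B ->
  mu (A i `&` B) != 0 -> mu (A i `\` B) != 0 ->
  exists A' : 'I_n.+1 -> set X, disjoint_family mu A'.
Proof.
move=> [mA A0 dA] mB IB DB.
have fin C : measurable C -> C `<=` A i -> mu C != 0 -> (0 < mu C < +oo)%E.
  move=> mC CA C0; rewrite lt0e C0 measure_ge0/=.
  case/andP: (A0 i) => _; apply: le_lt_trans.
  by apply: le_measure => //; rewrite inE.
have mI : measurable (A i `&` B) by exact: measurableI.
have mD : measurable (A i `\` B) by exact: measurableD.
apply: (@disjoint_family_extend n
  (fun j => if j == i then A i `\` B else A j) (A i `&` B)) => //.
- split=> [j|j|j j' x].
  + by case: ifP.
  + by case: ifP => // _; apply: fin => // x [].
  + by do 2![case: eqVneq => [->|_]] => //; [move=> [? _]|move=> + [? _]|];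
      move=> *; apply: dA; eauto.
- by apply: fin => // x [].
- move=> j x; case: eqVneq => [_ [_ +] []//|ji Aj [Ai _]].
  by move/eqP: ji; apply; exact: dA Aj Ai.
Qed.

(* A family that cannot be enlarged consists of atoms and covers every set of
   finite measure up to a null set, so its indicators would span L_p. *)
Lemma infinite_dim_disjoint_ord : ~ finite_dimensional Lp ->
  forall n, exists A : 'I_n -> set X, disjoint_family mu A.
Proof.
move=> infdim; elim=> [|n [A dA]].
  by exists (fun=> set0); split=> [] [].
apply: contrapT => maxA; apply: infdim.
have [mA A0 djA] := dA.
have Afin i : (mu (A i) < +oo)%E by case/andP: (A0 i).
pose U := \bigcup_i A i.
have mU : measurable U by apply: fin_bigcup_measurable => //; exact: finite_finset.
have split i B : measurable B -> mu (A i `&` B) = 0 \/ mu (A i `\` B) = 0.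
  move=> mB; have [|IB] := eqVneq (mu (A i `&` B)) 0; first by left.
  have [|DB] := eqVneq (mu (A i `\` B)) 0; first by right.
  by case: maxA; exact: disjoint_family_split dA mB IB DB.
have outside B : measurable B -> (mu B < +oo)%E -> mu (B `\` U) = 0.
  move=> mB Bfin; apply: contrapT => /eqP B0; apply: maxA.
  have mBU : measurable (B `\` U) by exact: measurableD.
  apply: (disjoint_family_extend dA mBU); last by move=> i x Ai [_ ]; apply; exists i.
  rewrite lt0e B0 measure_ge0/=; apply: le_lt_trans Bfin.
  by apply: le_measure => //; rewrite ?inE.
exists n, (fun i => Lsp_class (Lfun_Sub p1 (indic_Lfun p1 (mA i) (Afin i)))) => F.
have mF := @Lf_measurable _ _ _ _ _ _ (Lsp_repr F).
have cst i : exists a : R, {ae mu, forall x, A i x -> Lsp_repr F x = a}.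
  by apply: const_on_atom => //; [case/andP: (A0 i)|exact: split].
have {cst} [a aP] := choice cst.
exists a.
(* The support of [F] is the union of the level sets at height [1 / (k + 1)]. These have finite
   measure, so their parts outside [U] are null. *)
have out0 : {ae mu, forall x, ~ U x -> Lsp_repr F x = 0}.
  apply: (negligibleS
      (A := \bigcup_k ([set x | (k.+1%:R^-1 <= `|Lsp_repr F x|)%R] `\` U))).
    move=> x /= /not_implyP[Ux /eqP Fx].
    have Fx0 : 0 < `|Lsp_repr F x| by rewrite normr_gt0.
    exists (Num.truncn (`|Lsp_repr F x|^-1)) => //; split=> //=.
    by rewrite invf_ple ?posrE ?ltr0n// ltW// truncnS_gt.
  apply: negligible_bigcup => k.
  have [mk kfin] := finite_measure_level p1 mF (integrable_Lsp_repr F)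
    (e := k.+1%:R^-1) ltac:(by rewrite invr_gt0 ltr0n).
  by apply/negligibleP; [exact: measurableD|exact: outside].
rewrite -{1}(Lsp_reprK F).
under eq_bigr do rewrite -Lsp_classZ.
rewrite -Lsp_class_sum; apply: Lsp_class_eq.
have aall : {ae mu, forall x (i : 'I_n), A i x -> Lsp_repr F x = a i}.
  (* The finite index is routed through a natural number [k], as the countable intersection of full
     sets is indexed by [nat]. *)
  have := ae_foralln (P := fun k x => forall i : 'I_n, k = i :> nat ->
    A i x -> Lsp_repr F x = a i).
  move=> h; suff : {ae mu, forall x k (i : 'I_n), k = i :> nat ->
    A i x -> Lsp_repr F x = a i} by apply: filterS => x + i => /(_ i i erefl).
  apply: h => k; have [kn|nk] := ltnP k n; last first.
    by apply: aeW => x i ki; move: (ltn_ord i); rewrite -ki ltnNge nk.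
  by apply: filterS (aP (Ordinal kn)) => x + i ki; rewrite (_ : Ordinal kn = i)//; exact: val_inj.
apply: filterS2 out0 aall => x ox ax _; rewrite Lfun_sumE.
have wE i : (a i *: Lfun_Sub p1 (indic_Lfun p1 (mA i) (Afin i)) : LfunType mu p1) x =
    a i * \1_(A i) x by [].
under eq_bigr do rewrite wE.
have [[i _ Ai]|nU] := pselect (U x).
  rewrite (ax i Ai) (bigD1 i)//= big1 ?addr0 ?indicE ?mem_set ?mulr1// => j /eqP ji.
  by rewrite indicE memNset ?mulr0// => Aj; apply: ji; exact: djA Aj Ai.
rewrite ox// big1// => i _; rewrite indicE memNset ?mulr0// => Ai.
by apply: nU; exists i.
Qed.

Lemma infinite_dim_disjoint : ~ finite_dimensional Lp ->
  forall I : finType, exists A : I -> set X, disjoint_family mu A.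
Proof.
move=> infdim I; have [A [mA A0 dA]] := infinite_dim_disjoint_ord infdim #|I|.
exists (A \o enum_rank); split=> [i|i|i j x Ai Aj] //=.
by apply: enum_rank_inj; exact: dA Ai Aj.
Qed.

End infinite_dimension.

(** * Maps into l_1 *)

Section upper_bound.
Context (R : realType) (p : R) (p2 : 2 < p) (M : metricType R).
Hypothesis lpM : forall I : finType, exists u : (I -> R) -> M,
  forall c c', mdist (u c) (u c') `^ p = \sum_i `|c i - c' i| `^ p.

Let p_gt0 : 0 < p. Proof. by apply: lt_trans p2; rewrite ltr0n. Qed.

Lemma powR_le_inv (a b : R) : 0 <= b -> a `^ p <= b `^ p -> a <= b.
Proof.
move=> b0; apply: contraTT; rewrite -!ltNge => ba.
by apply: gt0_ltr_powR => //; rewrite nnegrE// ltW// (le_lt_trans b0).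
Qed.

(** Here [2 < p] is decisive: with [n = L ^ 2] and torus steps of length at most [t], antipodes lie
    at distance at least [t * L / (2 * L ^ 2) ^ (1 / p)], which must reach [T]. The exponent [p - 2]
    being positive, a large [L] works. *)
Lemma exists_large_scale (t T : R) : 0 < t -> 0 < T -> exists2 L : nat, (0 < L)%N &
  2 * T `^ p <= t `^ p * L%:R `^ (p - 2).
Proof.
move=> t0 T0; have q0 : 0 < p - 2 by rewrite subr_gt0.
set a := 2 * T `^ p / t `^ p.
have tp : 0 < t `^ p by exact: powR_gt0.
have a0 : 0 <= a by rewrite divr_ge0 ?mulr_ge0 ?powR_ge0// ltW.
exists (Num.truncn (a `^ (p - 2)^-1)).+1 => //.
rewrite -ler_pdivrMl// mulrC -/a.
apply: (@le_trans _ _ ((a `^ (p - 2)^-1) `^ (p - 2))).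
  by rewrite -powRrM mulVf ?gt_eqF// powRr1.
apply: ge0_ler_powR; rewrite ?nnegrE ?powR_ge0 ?ler0n ?(ltW q0)//.
by rewrite ltW// truncnS_gt.
Qed.

(** With [n = L ^ 2] the factor [12 * L ^ 2 + 6 * n] is [18 * n]. The left side of the inequality
    has [n] directions, each contributing at least [K] per point; every average on the right is at
    most [w]. *)
Lemma coarse_ell1_bound (phi : M -> ell1 R) (t T w K : R) : 0 < t -> 0 < T ->
  (forall x y, mdist x y <= t -> `|phi x - phi y| <= w) ->
  (forall x y, T <= mdist x y -> K <= `|phi x - phi y|) ->
  K <= 18 * w.
Proof.
move=> t0 T0 small large.
have [L L0 LtT] := exists_large_scale t0 T0.
pose n := (L ^ 2)%N.
have n0 : (0 < n)%N by rewrite expn_gt0 L0.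
have nR : n%:R = L%:R ^+ 2 :> R by rewrite natrX.
have n0R : 0 < n%:R :> R by rewrite ltr0n.
have [u uE] := lpM ('I_n * bool)%type.
(* Chosen so that moving each of the [2 * n] coordinates by at most [r] gives a displacement of at
   most [t]. *)
pose r := t / (2 * n%:R) `^ p^-1.
have r0 : 0 < r by rewrite divr_gt0// powR_gt0// mulr_gt0.
have rp : r `^ p = t `^ p / (2 * n%:R).
  rewrite powRM ?(ltW t0) ?invr_ge0 ?powR_ge0//; congr (_ * _).
  by rewrite -powRN -powRrM mulNr mulVf ?gt_eqF// powRN powRr1.
pose G := 'rV['Z_(4 * L)]_n.
(* Each cyclic factor gets two coordinates, the tent and its translate by a quarter turn, one of
   which always detects the antipode. *)
pose c (x : G) (i : 'I_n * bool) : R :=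
  r * (ctent (x 0 i.1 + L%:R *+ i.2))%:R.
pose F (x : G) := phi (u (c x)).
pose s : seq G := [seq delta_mx 0 j | j <- enum 'I_n].
have ss : size s = n by rewrite size_map size_enum_ord.
have cB (x y : G) i : `|c y i - c x i| `^ p = r `^ p *
    `|(ctent (y 0 i.1 + L%:R *+ i.2))%:R - (ctent (x 0 i.1 + L%:R *+ i.2))%:R| `^ p.
  by rewrite -mulrBr normrM powRM ?normr_ge0// gtr0_norm.
have near x : cube_avg s (fun y => `|F y - F x|) x <= w.
  apply: cube_avg_le => b _; set h := \sum_(_ <- _) _.
  apply: small; apply: powR_le_inv; first exact: ltW.
  rewrite uE; apply: (@le_trans _ _ (\sum_(i : 'I_n * bool) r `^ p)).
    apply: ler_sum => i _; rewrite cB ler_piMr ?powR_ge0//.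
    apply: (@le_trans _ _ (1 `^ p)); last by rewrite powR1.
    apply: ge0_ler_powR; rewrite ?nnegrE ?(ltW p_gt0)//.
    by rewrite mxE addrAC; apply: ctent_lip => //; apply: cube_step_coord; exact: enum_uniq.
  rewrite sumr_const card_prod card_ord card_bool rp -[_ *+ (n * 2)]mulr_natl natrM.
  by rewrite [n%:R * 2]mulrC mulrCA divff ?mulr1// gt_eqF// mulr_gt0.
have far x e : e \in s -> K <= `|F (x + e *+ (2 * L)) - F x|.
  move=> /mapP[j _ ->]; apply: large; apply: powR_le_inv; first exact: mdist_ge0.
  have rL : T `^ p <= r `^ p * L%:R `^ p.
    have LE : L%:R `^ p = L%:R `^ (p - 2) * n%:R :> R.
      rewrite -{1}(subrK 2 p) (@powRD _ _ (p - 2) 2); last first.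
        by apply/implyP => _; rewrite pnatr_eq0 -lt0n.
      by rewrite powR_mulrn ?ler0n// nR.
    rewrite rp LE [leRHS](_ : _ = t `^ p * L%:R `^ (p - 2) / 2).
      by rewrite ler_pdivlMr// mulrC.
    by field; rewrite gt_eqF.
  apply: (le_trans rL); rewrite uE.
  (* A single coordinate moving by [r * L] already gives the required distance. *)
  suff [i Hi] : exists i : 'I_n * bool,
      L%:R <= `|(ctent ((x + delta_mx 0 j *+ (2 * L)) 0 i.1 + L%:R *+ i.2))%:R -
        (ctent (x 0 i.1 + L%:R *+ i.2))%:R| :> R.
    rewrite (bigD1 i)//= -[leLHS]addr0; apply: lerD; last first.
      by apply: sumr_ge0 => k _; exact: powR_ge0.
    rewrite cB ler_wpM2l ?powR_ge0//.
    by apply: ge0_ler_powR; rewrite ?nnegrE ?(ltW p_gt0).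
  have xj : (x + delta_mx 0 j *+ (2 * L)) 0 j = x 0 j + (2 * L)%:R.
    by rewrite !mxE mulmxnE mxE !eqxx.
  have [H|H] := ctent_far L0 R (x 0 j).
    by exists (j, false); rewrite /= xj !mulr0n !addr0.
  by exists (j, true); rewrite /= xj !mulr1n.
have := poincare_ell1 s F L; rewrite ss -nR => P.
have G0 : 0 < #|G|%:R :> R by rewrite ltr0n; apply/card_gt0P; exists 0.
have {}P : n%:R * #|G|%:R * K <= 18 * n%:R * #|G|%:R * w.
  apply: le_trans (le_trans P _).
    apply: (@le_trans _ _ (\sum_(e <- s) \sum_(x : G) K)).
      rewrite big_const_seq count_predT ss iter_addr_0 sumr_const.
      by rewrite -[K *+ _]mulr_natl -[(_ * K) *+ n]mulr_natl mulrA.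
    rewrite big_seq [leRHS]big_seq; apply: ler_sum => e es.
    by apply: ler_sum => x _; exact: far.
  apply: (@le_trans _ _ ((12 * n%:R + 6 * n%:R) * \sum_(x : G) w)).
    rewrite ler_pM2l; first by apply: ler_sum => x _; exact: near.
    by rewrite -mulrDl mulr_gt0// -natrD ltr0n.
  by rewrite sumr_const -[w *+ _]mulr_natl -mulrDl -natrD !mulrA.
rewrite -(ler_pM2l n0R) -(ler_pM2l G0); lra.
Qed.

End upper_bound.

(** * Separability of L_p *)

Section separability.
Context (R : realType) (d : measure_display) (X : measurableType d).
Variables (mu : {measure set X -> \bar R}) (p : R) (p1 : (1 <= p%:E)%E).
Local Notation Lp := (LspaceType mu p1).

Let p_gt0 : 0 < p.
Proof. by apply: lt_le_trans ltr01 _; rewrite -lee_fin. Qed.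

Let p_neq0 : p != 0. Proof. exact: lt0r_neq0. Qed.

Lemma Lfun_le (f g : X -> R) : measurable_fun setT f -> measurable_fun setT g ->
  (forall x, `|f x| <= `|g x|) -> g \in Lfun mu p%:E -> f \in Lfun mu p%:E.
Proof.
move=> mf mg fg gL; apply: mem_Lfun => //.
apply: le_lt_trans (integrable_Lsp_repr (Lsp_class (Lfun_Sub p1 gL))).
rewrite -Lsp_norm_powR Lsp_reprK Lsp_norm_powR.
apply: ge0_le_integral => //.
- exact: measurable_powR_norm.
- exact: measurable_powR_norm.
- by move=> x _; rewrite lee_fin ge0_ler_powR ?nnegrE// ltW.
Qed.

Section dense_family.
Variable B : nat -> set X.
Hypotheses (mB : forall n, measurable (B n)) (Bfin : forall n, (mu (B n) < +oo)%E).
Hypothesis B_dense : forall (A : set X) (e : R), measurable A ->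
  (mu A < +oo)%E -> 0 < e -> exists n, (mu (A `+` B n) < e%:E)%E.

Let b n : Lp := Lsp_class (Lfun_Sub p1 (indic_Lfun p1 (mB n) (Bfin n))).

(** Indexing by lists of pairs makes the index type a [countType], ready to be numbered by
    [pickle]. *)
Definition ratcomb (l : seq (rat * nat)) : Lp :=
  \sum_(qn <- l) ratr qn.1 *: b qn.2.

Definition approximable (F : Lp) := forall e : R, 0 < e ->
  exists l, `|F - ratcomb l| < e.

Lemma approximable_closed F :
  (forall e, 0 < e -> exists2 G, approximable G & `|F - G| < e) ->
  approximable F.
Proof.
move=> H e e0; have e2 : 0 < e / 2 by rewrite divr_gt0.
have [G aG FG] := H _ e2; have [l Gl] := aG _ e2; exists l.
rewrite -(subrKA G) (splitr e); apply: le_lt_trans (ler_normD _ _) _.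
exact: ltrD.
Qed.

Lemma approximableD F G : approximable F -> approximable G ->
  approximable (F + G).
Proof.
move=> aF aG e e0; have e2 : 0 < e / 2 by rewrite divr_gt0.
have [l Fl] := aF _ e2; have [l' Gl] := aG _ e2; exists (l ++ l').
rewrite /ratcomb big_cat opprD addrACA (splitr e).
by apply: le_lt_trans (ler_normD _ _) _; exact: ltrD.
Qed.

Lemma approximable0 : approximable 0.
Proof. by move=> e e0; exists [::]; rewrite /ratcomb big_nil subrr normr0. Qed.

Lemma approximableZ a F : approximable F -> approximable (a *: F).
Proof.
move=> aF e e0; have e2 : 0 < e / 2 by rewrite divr_gt0.
have a1 : 0 < `|a| + 1 by rewrite ltr_wpDl.
(* First [l] is chosen in terms of [a], then the rational [q] close to [a] in terms of the norm of
   [ratcomb l]. The added 1 keeps both divisors positive. *)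
have [l Fl] := aF (e / 2 / (`|a| + 1)) (divr_gt0 e2 a1).
have z1 : 0 < `|ratcomb l| + 1 by rewrite ltr_wpDl.
have dz : 0 < e / 2 / (`|ratcomb l| + 1) by exact: divr_gt0.
have aq : a < a + e / 2 / (`|ratcomb l| + 1) by rewrite ltrDl.
have [q] := rat_in_itvoo aq; rewrite in_itv /= => /andP[aq1 aq2].
exists [seq (q * rn.1, rn.2) | rn <- l].
have -> : ratcomb [seq (q * rn.1, rn.2) | rn <- l] = ratr q *: ratcomb l.
  rewrite /ratcomb big_map scaler_sumr; apply: eq_bigr => -[r n] _ /=.
  by rewrite rmorphM scalerA.
rewrite (_ : _ - _ = a *: (F - ratcomb l) + (a - ratr q) *: ratcomb l); last first.
  by rewrite scalerBr scalerBl subrKA.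
rewrite (splitr e); apply: le_lt_trans (ler_normD _ _) _; rewrite !normrZ.
apply: ler_ltD.
  apply: (@le_trans _ _ (`|a| * (e / 2 / (`|a| + 1)))).
    by apply: ler_wpM2l => //; exact: ltW.
  by rewrite mulrCA ler_piMr ?(ltW e2)// ler_pdivrMr// mul1r lerDl.
apply: (@le_lt_trans _ _ (e / 2 / (`|ratcomb l| + 1) * `|ratcomb l|)).
  apply: ler_wpM2r => //; rewrite distrC gtr0_norm ?subr_gt0// lerBlDl.
  exact: ltW.
by rewrite mulrAC -mulrA gtr_pMr// ltr_pdivrMr// mul1r ltrDl.
Qed.

Lemma approximable_sum (I : finType) (F : I -> Lp) :
  (forall i, approximable (F i)) -> approximable (\sum_i F i).
Proof.
move=> aF; elim/big_ind : _ => //; first exact: approximable0.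
by move=> ? ?; exact: approximableD.
Qed.

(** The [p]-th power of the difference of two indicators is the indicator of the symmetric
    difference, so closeness [e ^ p] in measure is closeness [e] in norm. *)
Lemma approximable_indic (A : set X) (mA : measurable A) (Afin : (mu A < +oo)%E) :
  approximable (Lsp_class (Lfun_Sub p1 (indic_Lfun p1 mA Afin))).
Proof.
move=> e e0; have [n Bn] := B_dense mA Afin (powR_gt0 p e0).
exists [:: (1, n)]; rewrite /ratcomb big_seq1 /= rmorph1 scale1r -Lsp_classB.
apply: contraT; rewrite -leNgt => le.
suff : ((e `^ p)%:E <= mu (A `+` B n))%E by rewrite leNgt Bn.
have {}le : e `^ p <= `|Lsp_class (Lfun_Sub p1 (indic_Lfun p1 mA Afin) -
    Lfun_Sub p1 (indic_Lfun p1 (mB n) (Bfin n)))| `^ p.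
  by apply: ge0_ler_powR; rewrite ?nnegrE ?(ltW e0) ?(ltW p_gt0).
rewrite -lee_fin Lsp_norm_powR in le; apply: (le_trans le).
have mAB : measurable (A `+` B n).
  by apply: measurableU; exact: measurableD.
rewrite -[X in (_ <= mu X)%E]setIT -integral_indic//.
rewrite le_eqVlt; apply/orP; left; apply/eqP; apply: eq_integral => x _.
have -> : (Lfun_Sub p1 (indic_Lfun p1 mA Afin) - Lfun_Sub p1
  (indic_Lfun p1 (mB n) (Bfin n)) : LfunType mu p1) x = \1_A x - \1_(B n) x by [].
congr EFin; rewrite !indicE.
have -> : (x \in A `+` B n) = (x \in A) (+) (x \in B n).
  by rewrite /setY in_setU !in_setD; do 2 case: (x \in _).
by do 2 case: (x \in _); rewrite /= ?subrr ?sub0r ?subr0 ?normrN ?normr1 ?normr0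
  ?powR1 ?powR0.
Qed.

Import HBNNSimple.

(** The set where [s] takes a value [v > 0] lies in the level set of [f] at height [v], hence has
    finite measure; the value 0 contributes nothing. *)
Lemma approximable_simple (s : {nnsfun X >-> R}) (f : LfunType mu p1) :
  (forall x, s x <= `|f x|) ->
  exists2 g : LfunType mu p1, g = s :> (X -> R) & approximable (Lsp_class g).
Proof.
move=> sf.
have s0 x : 0 <= s x by [].
have ms : measurable_fun setT s by [].
have mf := @Lf_measurable _ _ _ _ _ _ f.
have fi : (\int[mu]_x (`|f x| `^ p)%:E < +oo)%E by rewrite -Lsp_norm_powR ltry.
have level (v : R) : exists g : LfunType mu p1,
    (forall x, g x = v * \1_(s @^-1` [set v]) x) /\ approximable (Lsp_class g).
  have mv : measurable (s @^-1` [set v]) by exact: measurable_sfunP.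
  have [v0|v0] := leP v 0.
    exists 0; split; last exact: approximable0.
    move=> x; rewrite indicE; have [/set_mem/= sv|_] := boolP (x \in _); last by rewrite mulr0.
    have /eqP -> : v == 0 by rewrite eq_le v0 -sv s0.
    by rewrite mul0r.
  have [ml lfin] := finite_measure_level p1 mf fi v0.
  have vfin : (mu (s @^-1` [set v]) < +oo)%E.
    apply: le_lt_trans lfin; apply: le_measure; rewrite ?inE//.
    by move=> x /= <-.
  exists (v *: Lfun_Sub p1 (indic_Lfun p1 mv vfin)); split=> //.
  by rewrite Lsp_classZ; apply: approximableZ; exact: approximable_indic.
pose l : seq R := finmap.enum_fset (fset_set (range s)).
pose v (i : 'I_(size l)) := l`_i.
have [g gP] := choice (fun i => level (v i)).
exists (\sum_i g i).
  apply/funext => x; rewrite Lfun_sumE fimfunEord; apply: eq_bigr => i _.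
  exact: (gP i).1.
by rewrite Lsp_class_sum; apply: approximable_sum => i; exact: (gP i).2.
Qed.

Lemma cvg_powR0 (u : nat -> R) : (forall n, 0 <= u n) -> u @ \oo --> 0 ->
  (fun n => u n `^ p) @ \oo --> 0.
Proof.
move=> u0 cu; apply/cvgrPdist_lt => e e0.
have ep : 0 < e `^ p^-1 by exact: powR_gt0.
move/cvgrPdist_lt : cu => /(_ _ ep); apply: filterS => n.
rewrite !sub0r !normrN !ger0_norm ?powR_ge0// => un.
rewrite -[ltRHS](powRr1 (ltW e0)) -(mulVf p_neq0) powRrM.
by apply: gt0_ltr_powR; rewrite ?nnegrE ?powR_ge0.
Qed.

(** Simple functions below [f] converge to it pointwise, and the [p]-th power of [f] dominates those
    of the differences: dominated convergence gives convergence in norm. *)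
Lemma approximable_ge0 (f : LfunType mu p1) : (forall x, 0 <= f x) ->
  approximable (Lsp_class f).
Proof.
move=> f0; have mf := @Lf_measurable _ _ _ _ _ _ f.
have mEf : measurable_fun setT (EFin \o (f : X -> R)) by exact/measurable_EFinP.
pose s n := nnsfun_approx measurableT mEf n.
have sf n x : s n x <= f x.
  by rewrite -lee_fin /s nnsfun_approxE; apply: le_approx => // y _; rewrite lee_fin.
have sfn n x : s n x <= `|f x| by apply: le_trans (sf n x) _; exact: ler_norm.
have sfB n x : `|f x - s n x| <= `|f x|.
  by rewrite !ger0_norm ?subr_ge0// lerBlDr lerDl.
have scv x : (fun n => s n x) @ \oo --> f x.
  have f0' y : setT y -> (0 <= (EFin \o (f : X -> R)) y)%E by rewrite lee_fin.
  exact: (fine_cvg (cvg_nnsfun_approx measurableT mEf f0' I)).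
have [g gs aprg] : exists2 g : nat -> LfunType mu p1,
    forall n, g n = s n :> (X -> R) & forall n, approximable (Lsp_class (g n)).
  have [g gP] := choice (fun n => let: ex_intro2 g gs ga :=
    approximable_simple (sfn n) in ex_intro (fun g : LfunType mu p1 =>
      g = s n :> (X -> R) /\ approximable (Lsp_class g)) g (conj gs ga)).
  by exists g => n; have [] := gP n.
pose h n x := (`|(f - g n) x| `^ p)%:E.
have mfg n : measurable_fun setT (f - g n : LfunType mu p1).
  exact: Lf_measurable.
have hcv : (fun n => \int[mu]_x h n x)%E @ \oo --> 0%E.
  have [] := @dominated_convergence _ _ _ mu setT measurableT h (cst 0%E)
    (fun x => (`|f x| `^ p)%:E); last by rewrite integral0.
  - by move=> n; exact: measurable_powR_norm.
  - exact: measurable_cst.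
  - apply: aeW => x _; apply: cvg_EFin; first by apply: nearW => n.
    apply: cvg_powR0 => [n|]; first exact: normr_ge0.
    rewrite -(normr0 R); apply: cvg_norm; rewrite -[X in _ --> X](subrr (f x)).
    under eq_fun do rewrite /= gs.
    by apply: cvgB; [exact: cvg_cst|exact: scv].
  - apply/integrableP; split; first exact: measurable_powR_norm.
    under eq_integral do rewrite gee0_abs ?lee_fin ?powR_ge0//.
    by rewrite -Lsp_norm_powR ltry.
  - apply: aeW => x n _; rewrite gee0_abs ?lee_fin ?powR_ge0//.
    rewrite ge0_ler_powR ?nnegrE ?(ltW p_gt0)//=.
    by rewrite -[X in `|X|]/(f x - g n x) gs.
apply: approximable_closed => e e0.
have ep : 0 < e `^ p by exact: powR_gt0.
have hcv' : (fun n => fine (\int[mu]_x h n x)%E) @ \oo --> (0 : R).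
  exact: fine_cvg hcv.
move/cvgrPdist_lt : hcv' => /(_ _ ep) [N _ /(_ N (leqnn N))].
rewrite /= /h -Lsp_norm_powR /= sub0r normrN ger0_norm ?powR_ge0// => lt.
exists (Lsp_class (g N)) => //; rewrite -Lsp_classB ltNge; apply/negP => le.
suff : e `^ p <= `|Lsp_class (f - g N)| `^ p by rewrite leNgt lt.
by apply: ge0_ler_powR; rewrite ?nnegrE ?(ltW e0) ?(ltW p_gt0).
Qed.

Lemma approximable_all (F : Lp) : approximable F.
Proof.
rewrite -(Lsp_reprK F); set f := Lsp_repr F.
have mf := @Lf_measurable _ _ _ _ _ _ f.
have mfp : measurable_fun setT (fun x => Num.max (f x) 0).
  by apply: measurable_maxr.
have mfn : measurable_fun setT (fun x => Num.max (- f x) 0).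
  by apply: measurable_maxr => //; exact: measurableT_comp.
have maxB (a : R) : `|Num.max a 0| <= `|a|.
  rewrite ger0_norm ?le_max ?lexx ?orbT// ge_max normr_ge0 andbT.
  exact: ler_norm.
have Lfp : (fun x => Num.max (f x) 0) \in Lfun mu p%:E.
  by apply: (Lfun_le mfp mf) => [x|]; [exact: maxB|exact: LfunP].
have Lfn : (fun x => Num.max (- f x) 0) \in Lfun mu p%:E.
  apply: (Lfun_le mfn mf) => [x|]; last exact: LfunP.
  by rewrite -(normrN (f x)); exact: maxB.
have -> : Lsp_class f = Lsp_class (Lfun_Sub p1 Lfp) - Lsp_class (Lfun_Sub p1 Lfn).
  rewrite -Lsp_classB; congr Lsp_class; apply/LfuneqP => x.
  rewrite -[RHS]/(Num.max (f x) 0 - Num.max (- f x) 0).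
  case: (leP 0 (f x)) => h.
    by rewrite [Num.max (- _) _]max_r ?subr0// oppr_le0.
  by rewrite [Num.max (- _) _]max_l ?sub0r ?opprK// oppr_ge0 ltW.
rewrite -scaleN1r; apply: approximableD; last apply: approximableZ.
  by apply: approximable_ge0 => x; rewrite le_max lexx orbT.
by apply: approximable_ge0 => x; rewrite le_max lexx orbT.
Qed.

End dense_family.

Theorem Lsp_separable : separable_measure mu ->
  exists z : seq (rat * nat) -> Lp,
    forall F (e : R), 0 < e -> exists l, `|F - z l| < e.
Proof.
move=> [D [/countable_injP[h hinj] Dfin Ddense]].
(* The injection [h] turns [D] into a sequence, with the empty set at the integers that it
   misses. *)
have enum n : exists B, (measurable B /\ (mu B < +oo)%E) /\
    forall B', D B' -> h B' = n -> B' = B.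
  have [[B [DB hB]]|nB] := pselect (exists B, D B /\ h B = n).
    exists B; split=> [|B' DB' hB']; first exact: Dfin.
    by apply: hinj; rewrite ?inE// hB.
  exists set0; split=> [|B' DB' hB']; first by rewrite measure0 ltry.
  by case: nB; exists B'.
have [B BP] := choice enum.
have mB n : measurable (B n) by have [[]] := BP n.
have Bfin n : (mu (B n) < +oo)%E by have [[]] := BP n.
exists (ratcomb mB Bfin) => F e e0; apply: approximable_all e e0 => A e mA Afin e0.
have [B' DB' AB'] := Ddense A e mA Afin e0.
by exists (h B'); rewrite -((BP (h B')).2 B').
Qed.

End separability.

(** * The renormings of l_1 *)

Section ell1_pairing.
Context (R : realType).
Implicit Types (u v : ell1 R) (g : nat -> R).

Definition ell1_pair g u : R := limn (series (fun n => g n * u n)).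

Section bounded_pairing.
Variables (g : nat -> R) (k : R).
Hypotheses (k0 : 0 <= k) (gk : forall n, `|g n| <= k).

Lemma ell1_pair_normal_cvg u :
  cvgn (series (fun n => `|g n * u n|)) /\
  limn (series (fun n => `|g n * u n|)) <= k * `|u|.
Proof.
have cu : cvgn (k *: series (fun n => `|u n|)) by apply: is_cvgZl_tmp; exact: ell1_cvg.
have kE : k *: series (fun n => `|u n|) = series (fun n => k * `|u n|).
  by apply/funext => n; rewrite /series /= [LHS]scaler_sumr.
have le n : `|g n * u n| <= k * `|u n| by rewrite normrM ler_wpM2r.
have cg : cvgn (series (fun n => `|g n * u n|)).
  by apply: (series_le_cvg _ _ le) => //; rewrite -?kE// => n; rewrite mulr_ge0.
split=> //.
have -> : k * `|u| = limn (k *: series (fun n => `|u n|)).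
  by rewrite limZl_tmp//; exact: ell1_cvg.
apply: ler_lim => //; near=> n; rewrite kE /series /=.
by apply: ler_sum => i _; exact: le.
Unshelve. all: by end_near. Qed.

Lemma is_cvg_ell1_pair u : cvgn (series (fun n => g n * u n)).
Proof. by apply: normed_cvg; case: (ell1_pair_normal_cvg u). Qed.

Lemma ell1_pair_le u : `|ell1_pair g u| <= k * `|u|.
Proof.
have [c le] := ell1_pair_normal_cvg u.
by apply: le_trans le; exact: lim_series_norm.
Qed.

Lemma ell1_pairD u v : ell1_pair g (u + v) = ell1_pair g u + ell1_pair g v.
Proof.
rewrite /ell1_pair -limD; [|exact: is_cvg_ell1_pair|exact: is_cvg_ell1_pair].
congr (limn _); apply/funext => n; rewrite /series /=.
rewrite (eq_bigr (fun i => g i * u i + g i * v i)) ?big_split// => i _.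
exact: mulrDr.
Qed.

Lemma ell1_pairZ a u : ell1_pair g (a *: u) = a * ell1_pair g u.
Proof.
rewrite /ell1_pair -[a * _]/(a *: _) -limZl_tmp; last exact: is_cvg_ell1_pair.
congr (limn _); apply/funext => n; rewrite /series /= [RHS]scaler_sumr.
by apply: eq_bigr => i _; rewrite [LHS]mulrCA.
Qed.

End bounded_pairing.

Lemma series_delta (c : nat -> R) i :
  series (fun n => (n == i)%:R * c n) @ \oo --> c i.
Proof.
apply: cvg_near_cst; exists i.+1 => // n /= i_n.
rewrite /series /= (bigD1_seq i) ?mem_index_iota ?iota_uniq//=.
by rewrite eqxx mul1r big1 ?addr0// => j /negbTE ->; rewrite mul0r.
Qed.

Lemma ell1_delta_subproof i : ell1_pred (fun n => (n == i)%:R : R).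
Proof.
apply/asboolP.
have -> : (fun n => `|(n == i)%:R : R|) = (fun n => (n == i)%:R * cst 1 n).
  by apply/funext => n; rewrite normr_nat mulr1.
exact: cvgP (@series_delta (cst 1) i).
Qed.

Definition ell1_delta i : ell1 R := Ell1 (ell1_delta_subproof i).

Lemma ell1_pair_delta g i : ell1_pair g (ell1_delta i) = g i.
Proof.
apply/cvg_lim => //.
under eq_fun do rewrite mulrC.
exact: series_delta.
Qed.

Section dual_renorming.
Variables (k : R) (K : set (nat -> R)).
Hypothesis k_gt0 : 0 < k.
Hypothesis K_le : forall g, K g -> forall n, `|g n| <= k.
Hypothesis K_half : forall g, (forall n, `|g n| <= 2^-1) -> K g.

Definition dual_norm u : R := sup [set `|ell1_pair g u| | g in K].

Let K0 : K (fun=> 0).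
Proof. by apply: K_half => n; rewrite normr0. Qed.

Lemma dual_norm_ge g u : K g -> `|ell1_pair g u| <= dual_norm u.
Proof.
move=> Kg; apply: ub_le_sup; last by exists g.
exists (k * `|u|) => _ [h Kh <-]; apply: ell1_pair_le; first exact: ltW.
exact: K_le.
Qed.

Lemma dual_norm_le c u : (forall g, K g -> `|ell1_pair g u| <= c) ->
  dual_norm u <= c.
Proof.
move=> H; apply: ge_sup; first by exists `|ell1_pair (fun=> 0) u|, (fun=> 0).
by move=> _ [g Kg <-]; exact: H.
Qed.

Lemma dual_normD u v : dual_norm (u + v) <= dual_norm u + dual_norm v.
Proof.
apply: dual_norm_le => g Kg; rewrite (ell1_pairD (ltW k_gt0) (K_le Kg)).
by apply: le_trans (ler_normD _ _) _; apply: lerD; exact: dual_norm_ge.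
Qed.

Lemma dual_normZ a u : dual_norm (a *: u) = `|a| * dual_norm u.
Proof.
(* This inequality for all scalars suffices: for [a != 0] the converse is its instance at the
   inverse of [a]. *)
have le b v : dual_norm (b *: v) <= `|b| * dual_norm v.
  apply: dual_norm_le => g Kg; rewrite (ell1_pairZ (ltW k_gt0) (K_le Kg)).
  by rewrite normrM ler_wpM2l//; exact: dual_norm_ge.
apply/eqP; rewrite eq_le le/=.
have [->|a0] := eqVneq a 0.
  rewrite normr0 mul0r; apply: le_trans (dual_norm_ge _ K0); exact: normr_ge0.
rewrite mulrC -ler_pdivlMr ?normr_gt0// mulrC -normfV.
by apply: le_trans (le _ _); rewrite scalerA mulVf// scale1r.
Qed.

Lemma dual_norm_equiv u : 2^-1 * `|u| <= dual_norm u <= k * `|u|.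
Proof.
apply/andP; split; last first.
  apply: dual_norm_le => g Kg.
  by apply: ell1_pair_le; [exact: ltW|exact: K_le].
(* Half the sign sequence of [u] lies in [K] and pairs with [u] to half of its l_1 norm. *)
pose g n := 2^-1 * Num.sg (u n).
have Kg : K g.
  apply: K_half => n; rewrite normrM ger0_norm// ler_piMr//.
  by rewrite normr_sg lern1 leq_b1.
apply: le_trans (dual_norm_ge u Kg); apply: le_trans (ler_norm _).
rewrite /ell1_pair (_ : series _ = 2^-1 *: series (fun n => `|u n|)).
  by rewrite limZl_tmp//; exact: ell1_cvg.
apply/funext => n; rewrite /series /= [RHS]scaler_sumr; apply: eq_bigr => i _.
by rewrite /g -mulrA -normrEsg.
Qed.

Lemma dual_norm_eq0 u : dual_norm u = 0 -> u = 0.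
Proof.
move=> u0; apply/normr0_eq0/eqP; rewrite eq_le normr_ge0 andbT.
have /andP[+ _] := dual_norm_equiv u.
by rewrite u0 pmulr_rle0// invr_gt0.
Qed.

Definition dual_renorming : equiv_norm (ell1 R) :=
  @EquivNorm R (ell1 R) dual_norm dual_normD dual_normZ dual_norm_eq0
    (ex_intro _ 2^-1 (ex_intro _ k (And3
      (ltac:(by rewrite invr_gt0) : 0 < 2^-1 :> R) k_gt0 dual_norm_equiv))).

End dual_renorming.
End ell1_pairing.

(** * The lower bound, from a dense sequence *)

Section lower_bound.
Context (R : realType) (M : metricType R) (I : countType) (z : I -> M) (k : R).
Hypothesis k1 : 1 <= k.
Hypothesis z_dense : forall x (e : R), 0 < e -> exists i, mdist x (z i) < e.

(** Coordinates outside the range of [pickle] are only bounded, so sequences indexed by [nat] serve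
    any countable index type. *)
Definition net_lipschitz : set (nat -> R) := [set g |
  (forall n, `|g n| <= k) /\ forall i j, mdist (z i) (z j) <= 1 ->
    `|g (pickle i) - g (pickle j)| <= 1].

Let k_gt0 : 0 < k. Proof. exact: lt_le_trans k1. Qed.

Let net_le g : net_lipschitz g -> forall n, `|g n| <= k.
Proof. by case. Qed.

Let net_half g : (forall n, `|g n| <= 2^-1) -> net_lipschitz g.
Proof.
move=> g2; split=> [n|i j _].
  by apply: le_trans (g2 n) (le_trans _ k1); rewrite invf_le1// ler1n.
apply: le_trans (ler_normB _ _) _; rewrite (splitr 1) mul1r.
exact: lerD.
Qed.

Definition net_renorming : equiv_norm (ell1 R) :=
  dual_renorming k_gt0 net_le net_half.

Lemma net_renorming_CR : M -> (k%:E <= CR M (renormed net_renorming))%E.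
Proof.
move=> x0.
(* Points at distance at most 1/2 then have net points at distance at most 1/4 + 1/2 + 1/4 = 1, the
   scale in [net_lipschitz]. *)
have e0 : (0 : R) < 4^-1 by rewrite invr_gt0.
have [c cP] := choice (fun x => z_dense x e0).
pose phi (x : M) : renormed net_renorming := ell1_delta R (pickle (c x)).
have dphi x y : mdist (phi x) (phi y) =
    dual_norm net_lipschitz (ell1_delta R (pickle (c x)) - ell1_delta R (pickle (c y))) by [].
have pairE g x y : net_lipschitz g ->
    ell1_pair g (ell1_delta R (pickle (c x)) - ell1_delta R (pickle (c y))) =
    g (pickle (c x)) - g (pickle (c y)).
  move=> Kg; rewrite -scaleN1r (ell1_pairD (ltW k_gt0) (net_le Kg)).
  by rewrite (ell1_pairZ (ltW k_gt0) (net_le Kg)) !ell1_pair_delta mulN1r.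
have om : (omega phi <= 1)%E.
  apply: ge_ereal_inf; exists (omega_at phi 2^-1).
    by exists 2^-1 => //=; rewrite invr_gt0.
  apply: ge_ereal_sup => _ [[x y] /= xy <-]; rewrite lee_fin dphi.
  apply: dual_norm_le => // g Kg; rewrite pairE//; apply: Kg.2.
  have := cP x; have := cP y; rewrite (metric_sym x).
  have := metric_triangle (z (c x)) x (z (c y)).
  have := metric_triangle x y (z (c y)).
  lra.
have om0 : (0 <= omega phi)%E.
  apply: le_ereal_inf_tmp => _ [t t0 <-]; apply: le_ereal_sup_tmp.
  exists (mdist (phi x0) (phi x0))%:E; last by rewrite lee_fin mdist_ge0.
  by exists (x0, x0) => //=; rewrite mdistxx ltW.
have ka : (k%:E <= kappa phi)%E.
  (* Points at distance at least [k + 1] have net points at distance at least [k + 1/2], beyond the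
     truncation level [k]. *)
  apply: le_ereal_sup_tmp; exists (kappa_at phi (k + 1)).
    by exists (k + 1) => //=; rewrite addr_gt0.
  apply: le_ereal_inf_tmp => _ [[x y] /= xy <-]; rewrite lee_fin dphi.
  (* The truncated distance to [z (c x)] is 1-Lipschitz; it is 0 at [c x] and [k] at [c y]. *)
  pose g n := if unpickle n is Some i then Num.min k (mdist (z i) (z (c x))) else 0.
  have gE i : g (pickle i) = Num.min k (mdist (z i) (z (c x))) by rewrite /g pickleK.
  have Kg : net_lipschitz g.
    split=> [n|i j ij].
      rewrite /g; case: unpickle => [i|]; last by rewrite normr0 ltW.
      by rewrite ger0_norm ?ge_min ?lexx// le_min mdist_ge0 ltW.
    rewrite !gE; have := metric_triangle (z i) (z j) (z (c x)).
    have := metric_triangle (z j) (z i) (z (c x)); rewrite (metric_sym (z j) (z i)).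
    move=> t1 t2; rewrite ler_norml; apply/andP.
    by case: (leP k (mdist (z i) _)) => h1; case: (leP k (mdist (z j) _)) => h2;
      split; lra.
  apply: le_trans (dual_norm_ge k_gt0 net_le _ Kg); rewrite pairE// !gE mdistxx.
  have := cP x; have := cP y; rewrite [mdist y _]metric_sym.
  have := metric_triangle x (z (c x)) y; have := metric_triangle (z (c x)) (z (c y)) y.
  rewrite (metric_sym (z (c x)) (z (c y))).
  rewrite distrC; have k0 := k_gt0; case: (leP k 0) => h0; first lra.
  by case: (leP k (mdist _ _)) => h *; rewrite ger0_norm; lra.
apply: le_ereal_sup_tmp; exists (separation_ratio phi); first by exists phi.
(* If [omega phi] is 0, the ratio is infinite because [kappa phi] is positive; otherwise dividing by
   a number in (0, 1] does not decrease [kappa phi]. *)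
rewrite /separation_ratio; move: om om0; case: (omega phi) => [r| |] //=.
rewrite !lee_fin => r1; rewrite le_eqVlt => /predU1P[<-|r0].
  by rewrite inve0 gt0_muley ?leey// (lt_le_trans _ ka)// lte_fin.
rewrite inver gt_eqF// lee_pdivlMr//; apply: le_trans ka.
by rewrite -EFinM lee_fin ger_pMr.
Qed.

End lower_bound.

(** * Finiteness of the ratio for every renorming, and conclusion *)

Section coarse_ratio_bound.
Context (R : realType) (p : R) (p2 : 2 < p) (M : metricType R) (x0 : M).
Hypothesis lpM : forall I : finType, exists u : (I -> R) -> M,
  forall c c', mdist (u c) (u c') `^ p = \sum_i `|c i - c' i| `^ p.

Lemma CR_renormed_ell1 (N : equiv_norm (ell1 R)) : (CR M (renormed N) < +oo)%E.
Proof.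
have [c [C [c0 C0 NcC]]] := rnorm_equiv N.
(* Passing from [N] to the l_1 norm multiplies upper bounds by [1 / c] and lower bounds by
   [1 / C]. *)
pose B := 18 * C / c.
have B0 : 0 < B by rewrite divr_gt0// mulr_gt0.
apply: (@le_lt_trans _ _ B%:E); last exact: ltry.
apply: ge_ereal_sup => _ [phi _ <-].
have mE x y : mdist (phi x) (phi y) = N ((phi x : ell1 R) - phi y) by [].
(* Strictness provides a scale [t] with [omega_at phi t] below [w]; letting [w] decrease to
   [omega phi] then recovers the bound there. *)
have key (w : R) : (omega phi < w%:E)%E -> (kappa phi <= (B * w)%:E)%E.
  move=> /ereal_inf_lt[_ [t /= t0 <-]] tw.
  apply: ge_ereal_sup => _ [T /= T0 <-]; rewrite leNgt; apply/negP => BT.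
  (* As [kappa_at phi T] may be infinite, a real [K] below it is used instead. *)
  have [K BK KT] : exists2 K : R, B * w < K & (K%:E <= kappa_at phi T)%E.
    move: BT; case: (kappa_at phi T) => [r| |] //.
      by rewrite lte_fin => ?; exists r.
    by move=> _; exists (B * w + 1); rewrite ?leey// ltrDl.
  suff : K / C <= 18 * (w / c).
    rewrite ler_pdivrMr// leNgt => /negP; apply; apply: le_lt_trans BK.
    by rewrite le_eqVlt; apply/orP; left; apply/eqP; rewrite /B; field; rewrite gt_eqF.
  apply: (@coarse_ell1_bound R p p2 M lpM (phi : M -> ell1 R) t T) => // x y xy.
  - rewrite ler_pdivlMr// mulrC.
    have /andP[+ _] := NcC ((phi x : ell1 R) - phi y); move/le_trans; apply.
    rewrite -lee_fin; apply: ltW; apply: le_lt_trans tw; rewrite -mE.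
    by apply: ereal_sup_ubound; exists (x, y).
  - rewrite ler_pdivrMr// mulrC.
    have /andP[_ ] := NcC ((phi x : ell1 R) - phi y); apply: le_trans.
    rewrite -lee_fin; apply: (le_trans KT); rewrite -mE.
    by apply: ereal_inf_lbound; exists (x, y).
have om0 : (0 <= omega phi)%E.
  apply: le_ereal_inf_tmp => _ [t t0 <-]; apply: le_ereal_sup_tmp.
  exists (mdist (phi x0) (phi x0))%:E; last by rewrite lee_fin mdist_ge0.
  by exists (x0, x0) => //=; rewrite mdistxx ltW.
rewrite /separation_ratio; move: key om0.
case: (omega phi) => [w| |] //= key w0; last by rewrite invey mule0 lee_fin ltW.
have {}key : (kappa phi <= (B * w)%:E)%E.
  apply/lee_addgt0Pr => e e0; apply: le_trans (key (w + e / B) _) _.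
    by rewrite lte_fin ltrDl divr_gt0.
  by rewrite -EFinD lee_fin mulrDr mulrCA divff ?mulr1// gt_eqF.
(* When [omega phi] is 0, the bound forces [kappa phi] to be at most 0, and the convention for 0/0
   makes the ratio harmless. *)
have [wz|wn] := eqVneq w 0.
  rewrite wz mulr0 in key; rewrite wz inve0.
  by apply: (@le_trans _ _ 0%E); [exact: mule_le0_ge0|rewrite lee_fin ltW].
by rewrite inver (negbTE wn) lee_pdivrMr// lt0r wn -lee_fin.
Qed.

End coarse_ratio_bound.

Theorem theorem6p6 (R : realType) (d : measure_display) (X : measurableType d)
    (mu : {measure set X -> \bar R}) (p : R) (p2 : 2 < p)
    (mu_separable : separable_measure mu)
    (Z_infinite_dim :
      ~ finite_dimensional (LspaceType mu (exponent_ge1 p2)))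
    (k : nat) :
  exists Ek : equiv_norm (ell1 R),
    (k%:R%:E <= CR (LspaceType mu (exponent_ge1 p2)) (renormed Ek) < +oo)%E.
Proof.
have [z zP] := Lsp_separable (exponent_ge1 p2) mu_separable.
(* The net renorming is built for a bound of at least 1, whereas [k] may be 0; hence [k + 1]. *)
have k1 : (1 : R) <= k.+1%:R by rewrite ler1n.
exists (net_renorming z k1); apply/andP; split.
  apply: le_trans (net_renorming_CR k1 zP 0).
  by rewrite lee_fin ler_nat.
apply: (@CR_renormed_ell1 R p p2 (LspaceType mu (exponent_ge1 p2)) 0) => I.
have [A dA] := infinite_dim_disjoint Z_infinite_dim I.
by have [u uP] := disjoint_family_lp_isometry (exponent_ge1 p2) dA; exists u.
Qed.
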